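(* Let $m,n\ge 1$, let $u$ be a unitary $mn\times mn$ complex matrix, and let $\sigma$ be a defect free, row contractive representation of $\mathbb{F}_u^+$ on a Hilbert space $\mathcal{H}$. Then $\sigma$ has a unique minimal $*$-dilation: there is a minimal dilation of $\sigma$ to a $*$-representation of $\mathbb{F}_u^+$, and if $\pi_1$ on $\mathcal{K}_1$ (with embedding $J_1:\mathcal{H}\to\mathcal{K}_1$) and $\pi_2$ on $\mathcal{K}_2$ (with embedding $J_2:\mathcal{H}\to\mathcal{K}_2$) are two such minimal dilations to $*$-representations, then there is a unitary $U:\mathcal{K}_1\to\mathcal{K}_2$ with $J_2=UJ_1$ and $\pi_2(\cdot)=U\pi_1(\cdot)U^*$.
   Context: Let $u=(u_{(i,j),(i',j')})$ be a unitary matrix in $M_{mn}(\mathbb{C})$ with rows and columns indexed by $\{1,\dots,m\}\times\{1,\dots,n\}$. A (unital) representation $\sigma$ of $\mathbb{F}_u^+$ on a Hilbert space $\mathcal{H}$ means a choice of bounded operators $\sigma(e_1)=A_1,\dots,\sigma(e_m)=A_m$ and $\sigma(f_1)=B_1,\dots,\sigma(f_n)=B_n$ on $\mathcal{H}$ satisfying the commutation relations $$A_iB_j=\sum_{i'=1}^m\sum_{j'=1}^n u_{(i,j),(i',j')}B_{j'}A_{i'}\qquad(1\le i\le m,\ 1\le j\le n),$$ extended multiplicatively to words in $e_1,\dots,e_m,f_1,\dots,f_n$ with the empty word sent to $I$. $\sigma$ is row contractive if the row operators $[\sigma(e_1)\ \cdots\ \sigma(e_m)]:\mathcal{H}^m\to\mathcal{H}$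 and $[\sigma(f_1)\ \cdots\ \sigma(f_n)]:\mathcal{H}^n\to\mathcal{H}$ are contractions, and row isometric if both are isometries. A row contractive $\sigma$ is defect free if $\sum_{i=1}^m\sigma(e_i)\sigma(e_i)^*=I=\sum_{j=1}^n\sigma(f_j)\sigma(f_j)^*$. A $*$-representation of $\mathbb{F}_u^+$ is a row isometric, defect free representation. A representation $\pi$ on $\mathcal{K}$ is a dilation of $\sigma$ on $\mathcal{H}$ if there is an isometry $J:\mathcal{H}\to\mathcal{K}$ such that $J\mathcal{H}$ is semi-invariant for the range of $\pi$ (there is a $\pi$-invariant subspace $\mathcal{M}\perp J\mathcal{H}$ with $\mathcal{M}\oplus J\mathcal{H}$ also $\pi$-invariant) and $J^*\pi(\cdot)J=\sigma(\cdot)$. The dilation is minimal if the smallest subspace reducing $\pi$ and containing $J\mathcal{H}$ is $\mathcal{K}$. *)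

(* Defs.v *)
From HB Require Import structures.
From mathcomp Require Import all_boot all_order all_algebra.
From mathcomp Require Import complex.
From mathcomp Require Import all_classical reals topology normedtype.

Set Implicit Arguments.
Unset Strict Implicit.
Unset Printing Implicit Defensive.

Import Order.TTheory GRing.Theory Num.Theory.
Import numFieldNormedType.Exports.

Local Open Scope classical_set_scope.
Local Open Scope ring_scope.

(* The inner product is linear in its first argument and conjugate-linear in
   the second one. *)
HB.mixin Record CompleteNormedModule_isHilbert (R : realType) H
    of CompleteNormedModule R[i] H := {
  inner : {dot H for (@Num.conj R[i])} ;
  innerE : forall x : H, inner x x = `|x| ^+ 2
}.

#[short(type="hilbertType")]
HB.structure Definition Hilbert (R : realType) :=
  {H of CompleteNormedModule R[i] H & CompleteNormedModule_isHilbert R H}.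

Record bounded_op (R : realType) (H K : hilbertType R) := BoundedOp {
  bounded_op_linear :> {linear H -> K} ;
  bounded_opP :
    exists c : R[i], forall x : H, `|bounded_op_linear x| <= c * `|x|
}.

(* For a bounded A, the Riesz representation theorem says that there is exactly
   one such z for each y, so the default value 0 is never used. *)
Definition adjoint (R : realType) (H K : hilbertType R) (A : bounded_op H K)
    (y : K) : H :=
  xget 0 [set z : H | forall x : H, inner (A x) y = inner x z].

Definition isometric (R : realType) (H K : hilbertType R)
    (J : bounded_op H K) : Prop :=
  forall x : H, `|J x| = `|x|.

Definition unitary_op (R : realType) (H K : hilbertType R)
    (U : bounded_op H K) : Prop :=
  (forall x : H, adjoint U (U x) = x) /\ (forall y : K, U (adjoint U y) = y).

Definition closed_subspace (R : realType) (H : hilbertType R) (M : set H) :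
    Prop :=
  [/\ closed M, M 0 &
      forall (a : R[i]) (x y : H), M x -> M y -> M (a *: x + y)].

Definition ortho_compl (R : realType) (H : hilbertType R) (M : set H) :
    set H :=
  [set y : H | forall x : H, M x -> inner x y = 0].

(* The norm of the Hilbert space direct sum H^k. *)
Definition l2norm (R : realType) (H : hilbertType R) (k : nat)
    (x : 'I_k -> H) : R[i] :=
  sqrtC (\sum_(i < k) `|x i| ^+ 2).

Definition row_op (R : realType) (H : hilbertType R) (k : nat)
    (A : 'I_k -> bounded_op H H) (x : 'I_k -> H) : H :=
  \sum_(i < k) A i (x i).

(* The pair (i, j) indexes the row or column [mxvec_index i j] of u. *)
Record representation (R : realType) (m n : nat) (u : 'M[R[i]]_(m * n))
    (H : hilbertType R) := Representation {
  rep_e : 'I_m -> bounded_op H H ;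
  rep_f : 'I_n -> bounded_op H H ;
  rep_comm : forall (i : 'I_m) (j : 'I_n) (x : H),
    rep_e i (rep_f j x) =
      \sum_(i' < m) \sum_(j' < n)
        u (mxvec_index i j) (mxvec_index i' j') *: rep_f j' (rep_e i' x)
}.

Section Representations.
Context (R : realType) (m n : nat) (u : 'M[R[i]]_(m * n)).
Implicit Types H K : hilbertType R.

Definition rep_gen H (s : representation u H) (g : 'I_m + 'I_n) :
    bounded_op H H :=
  match g with inl i => rep_e s i | inr j => rep_f s j end.

(* Words in the generators e_i = inl i and f_j = inr j; the leftmost letter of
   a word acts last. *)
Definition rep_word H (s : representation u H) (w : seq ('I_m + 'I_n)) :
    H -> H :=
  foldr (fun g (T : H -> H) => rep_gen s g \o T) id w.

Definition row_contractive H (s : representation u H) : Prop :=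
  (forall x : 'I_m -> H, `|row_op (rep_e s) x| <= l2norm x) /\
  (forall x : 'I_n -> H, `|row_op (rep_f s) x| <= l2norm x).

Definition row_isometric H (s : representation u H) : Prop :=
  (forall x : 'I_m -> H, `|row_op (rep_e s) x| = l2norm x) /\
  (forall x : 'I_n -> H, `|row_op (rep_f s) x| = l2norm x).

Definition defect_free H (s : representation u H) : Prop :=
  (forall x : H, \sum_(i < m) rep_e s i (adjoint (rep_e s i) x) = x) /\
  (forall x : H, \sum_(j < n) rep_f s j (adjoint (rep_f s j) x) = x).

Definition star_representation H (s : representation u H) : Prop :=
  row_isometric s /\ defect_free s.

Definition invariant_under H (s : representation u H) (M : set H) : Prop :=
  forall (w : seq ('I_m + 'I_n)) (x : H), M x -> M (rep_word s w x).

Definition reducing H (s : representation u H) (M : set H) : Prop :=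
  [/\ closed_subspace M, invariant_under s M &
      invariant_under s (ortho_compl M)].

Definition semi_invariant H (s : representation u H) (L : set H) : Prop :=
  exists M : set H,
    [/\ closed_subspace M, M `<=` ortho_compl L, invariant_under s M &
        invariant_under s [set x + y | x in M & y in L]].

Definition dilation H K (s : representation u H) (p : representation u K)
    (J : bounded_op H K) : Prop :=
  [/\ isometric J, semi_invariant p (range J) &
      forall (w : seq ('I_m + 'I_n)) (x : H),
        adjoint J (rep_word p w (J x)) = rep_word s w x].

Definition minimal_dilation H K (s : representation u H)
    (p : representation u K) (J : bounded_op H K) : Prop :=
  dilation s p J /\ smallest (reducing p) (range J) = setT.

Definition minimal_star_dilation H K (s : representation u H)
    (p : representation u K) (J : bounded_op H K) : Prop :=
  minimal_dilation s p J /\ star_representation p.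

End Representations.

(* Main.v *)
Require Import Defs.
From HB Require Import structures.
From mathcomp Require Import all_boot all_order all_algebra.
From mathcomp Require Import complex ring.
From mathcomp Require Import all_classical reals interval_inference.
From mathcomp Require Import topology normedtype sequences.

(** Write A_i, B_j for the generators of the given representation on H, and put
    C_a = A_i B_j for a letter a = (i, j).  Both rows of generators are
    coisometric, hence so is the row C.

    Consider a dilation by row unitaries S_i, T_j on a space K containing H.
    Defect freeness forces H to be invariant under all S_i^* and T_j^*
    ([dilated_coisometry]).  The products W_a = S_i T_j are isometries with
    orthogonal ranges that add up to K, so a vector y of K has coordinates
    x_w = P_H W_w^* y, one for each word w in the letters a.  They satisfy the
    mean value relation x_w = sum_a C_a x_(wa), and the sum of |x_w|^2 over the
    words of any fixed length is at most |y|^2.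

    This dictates the construction.  The dilation space [model] consists of all
    functions from words to H that satisfy the mean value relation ([harmonic])
    and have bounded level sums.  As C is a row contraction, the level sums
    increase with the length, and the inner product is their limit; the space
    is complete because its elements converge word by word.  A vector h of H is
    embedded as the function w |-> C_w^* h.  The operators are forced as well:
    the commutation relations express W_b^* S_i and W_b^* T_j through S, T and
    W^*, which defines S_i and T_j on functions by recursion on the word
    ([lift_e], [lift_f]).  Induction on the word gives S_i T_j = W_(i,j) and
    T_j S_i = sum_a conj(u_(a,(i,j))) W_a ([lift_ef], [lift_fe]), from which the
    commutation relations follow.  Induction on the level, with unitarity of u,
    shows that the rows S and T are contractions ([lev_lift_e], [lev_lift_f]).
    Since both products of these two row contractions are unitary, each row is
    itself isometric and onto ([model_star]).  A vector orthogonal to a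
    reducing subspace that contains H has all its coordinates equal to zero,
    whence minimality ([model_minimal]).

    For uniqueness, the coordinate map from any *-dilation to [model] is a
    contraction that intertwines the generators and respects the embeddings of
    H ([to_model]).  If G is a contractive intertwiner between two minimal
    *-dilations that respects the embeddings, then G^* G and G G^* commute with
    all generators and their adjoints, so that their fixed vectors form
    reducing subspaces containing H.  By minimality G is unitary
    ([unitary_intertwiner]), and two minimal *-dilations are compared by going
    through [model]. *)

Set Implicit Arguments.
Unset Strict Implicit.
Unset Printing Implicit Defensive.

Import Order.TTheory GRing.Theory Num.Theory.
Import numFieldNormedType.Exports.

Local Open Scope classical_set_scope.
Local Open Scope ring_scope.

(** * Positive definite sesquilinear forms *)

Section DotSpace.
Context (C : numClosedFieldType) (U : lmodType C) (f : {dot U for @Num.conj C}).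

Lemma dotDl x y z : f (x + y) z = f x z + f y z.
Proof. exact: linearDl. Qed.

Lemma dotDr x y z : f x (y + z) = f x y + f x z.
Proof. exact: linearDr. Qed.

Lemma dotBl x y z : f (x - y) z = f x z - f y z.
Proof. exact: linearBl. Qed.

Lemma dotBr x y z : f x (y - z) = f x y - f x z.
Proof. exact: linearBr. Qed.

Lemma dotZl a x y : f (a *: x) y = a * f x y.
Proof. exact: linearZl_LR. Qed.

Lemma dotZr a x y : f x (a *: y) = a^* * f x y.
Proof. exact: linearZr_LR. Qed.

Lemma dot0l x : f 0 x = 0. Proof. exact: linear0l. Qed.

Lemma dot0r x : f x 0 = 0. Proof. exact: linear0r. Qed.

Lemma dotC x y : f x y = (f y x)^*.
Proof. by rewrite [LHS]hermC /= expr0 mul1r. Qed.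

Lemma dot_suml I (r : seq I) (P : pred I) (F : I -> U) y :
  f (\sum_(i <- r | P i) F i) y = \sum_(i <- r | P i) f (F i) y.
Proof. exact: linear_sumlz. Qed.

Lemma dot_sumr I (r : seq I) (P : pred I) (F : I -> U) y :
  f y (\sum_(i <- r | P i) F i) = \sum_(i <- r | P i) f y (F i).
Proof. exact: linear_sumr. Qed.

(** The squared distance from x to the line spanned by y.  It yields the
    Cauchy-Schwarz inequality, and below the first-order condition satisfied by
    almost closest points of a subspace. *)
Lemma dot_pythagoras x y : y != 0 ->
  f (x - (f x y / f y y) *: y) (x - (f x y / f y y) *: y) =
  f x x - `|f x y| ^+ 2 / f y y.
Proof.
move=> y0; have fy : f y y != 0 by rewrite dnorm_eq0.
have fyJ : (f y y)^* = f y y by rewrite -dotC.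
rewrite !dotBl !dotBr !dotZl !dotZr normCK (dotC y x).
rewrite -[(f x y / f y y)^*]/(Num.conj_op _) rmorphM fmorphV /= fyJ.
by field.
Qed.

Lemma dot_CauchySchwarz x y : `|f x y| ^+ 2 <= f x x * f y y.
Proof.
have [->|y0] := eqVneq y 0; first by rewrite !dot0r normr0 expr0n mulr0.
by rewrite -ler_pdivrMr ?dnorm_gt0 // -subr_ge0 -dot_pythagoras ?dnorm_ge0.
Qed.

Lemma dot_triangle x y :
  sqrtC (f (x + y) (x + y)) <= sqrtC (f x x) + sqrtC (f y y).
Proof.
rewrite -ler_sqr ?nnegrE ?addr_ge0 ?sqrtC_ge0 ?dnorm_ge0 //.
rewrite sqrrD !sqrtCK dnormD addrAC lerD2r lerD2l.
have dR : f x y + (f x y)^* \is Num.real.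
  by rewrite CrealE rmorphD /= conjCK addrC.
apply: le_trans (real_ler_norm dR) _.
apply: le_trans (ler_normD _ _) _.
rewrite norm_conjC -mulr2n lerMn2r /=.
rewrite -sqrtCM ?nnegrE ?dnorm_ge0 // -(sqrCK (normr_ge0 _)).
by rewrite ler_sqrtC ?nnegrE ?exprn_ge0 ?mulr_ge0 ?dnorm_ge0 // dot_CauchySchwarz.
Qed.

End DotSpace.

(** * Orthogonal complements, the Riesz theorem and adjoints *)

Lemma linear_le_continuous (C : numFieldType) (V W : normedModType C)
    (f : {linear V -> W}) (c : C) :
  (forall x, `|f x| <= c * `|x|) -> continuous f.
Proof.
move=> fc; apply/bounded_linear_continuous/linear_boundedP.
near=> r => x; have [->|x0] := eqVneq x 0; first by rewrite linear0 !normr0 mulr0.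
apply: le_trans (fc _) _; rewrite ler_wpM2r //.
have c0 : 0 <= c.
  by rewrite -(@pmulr_lge0 _ `|x|) ?normr_gt0 //; apply: le_trans (fc x).
rewrite -(ger0_norm c0).
by near: r; apply: nbhs_pinfty_ge.
Unshelve. all: by end_near. Qed.

Lemma closed_linear_ker (C : numFieldType) (V W : normedModType C)
    (f : {linear V -> W}) (c : C) :
  (forall x, `|f x| <= c * `|x|) -> closed [set x | f x = 0].
Proof.
move=> fc; apply: (@closed_comp _ _ f [set 0]) => [x _|].
  exact: (linear_le_continuous fc).
exact/accessible_closed_set1/hausdorff_accessible/norm_hausdorff.
Qed.

Lemma norm_small_eq0 (C : numFieldType) (a c : C) : 0 <= c ->
  (forall e, 0 < e -> `|a| <= e * c) -> a = 0.
Proof.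
move=> c0 ac; apply/eqP/negP => /negP a0.
have c1 : 0 < c + 1 by rewrite ltr_wpDl.
have := ac (`|a| / (c + 1)); rewrite divr_gt0 ?normr_gt0 // => /(_ isT).
rewrite mulrAC ler_pdivlMr // ler_pM2l ?normr_gt0 //.
by rewrite gerDl ler10.
Qed.

(** The inner product with values in the syntactic type R[i], for which the norm
    and order lemmas on R[i] are found by unification. *)
Definition dotp (R : realType) (H : hilbertType R) (x y : H) : R[i] :=
  inner x y.

Section HilbertSpace.
Context (R : realType) (H : hilbertType R).
Implicit Types (x y z : H) (M : set H).

Lemma dotpDl x y z : dotp (x + y) z = dotp x z + dotp y z.
Proof. exact: dotDl. Qed.

Lemma dotpDr x y z : dotp x (y + z) = dotp x y + dotp x z.
Proof. exact: dotDr. Qed.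

Lemma dotpBl x y z : dotp (x - y) z = dotp x z - dotp y z.
Proof. exact: dotBl. Qed.

Lemma dotpBr x y z : dotp x (y - z) = dotp x y - dotp x z.
Proof. exact: dotBr. Qed.

Lemma dotpZl a x y : dotp (a *: x) y = a * dotp x y.
Proof. exact: dotZl. Qed.

Lemma dotpZr a x y : dotp x (a *: y) = a^* * dotp x y.
Proof. exact: dotZr. Qed.

Lemma dotp0l x : dotp 0 x = 0. Proof. exact: dot0l. Qed.

Lemma dotp0r x : dotp x 0 = 0. Proof. exact: dot0r. Qed.

Lemma dotpC x y : dotp x y = (dotp y x)^*.
Proof. exact: dotC. Qed.

Lemma dotp_suml I (r : seq I) (P : pred I) (F : I -> H) y :
  dotp (\sum_(i <- r | P i) F i) y = \sum_(i <- r | P i) dotp (F i) y.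
Proof. exact: dot_suml. Qed.

Lemma dotp_sumr I (r : seq I) (P : pred I) (F : I -> H) y :
  dotp y (\sum_(i <- r | P i) F i) = \sum_(i <- r | P i) dotp y (F i).
Proof. exact: dot_sumr. Qed.

Lemma dotpp x : dotp x x = `|x| ^+ 2.
Proof. exact: innerE. Qed.

Lemma dotpp_ge0 x : 0 <= dotp x x.
Proof. by rewrite dotpp exprn_ge0. Qed.

Lemma dotpp_eq0 x : (dotp x x == 0) = (x == 0).
Proof. by rewrite dotpp expf_eq0 /= normr_eq0. Qed.

Lemma dotp_norm x y : `|dotp x y| <= `|x| * `|y|.
Proof.
rewrite -ler_sqr ?nnegrE ?mulr_ge0 // exprMn -!dotpp.
exact: dot_CauchySchwarz.
Qed.

Lemma eq_of_dotp x y : (forall z, dotp z x = dotp z y) -> x = y.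
Proof.
move=> xy; apply/eqP; rewrite -subr_eq0 -dotpp_eq0.
by rewrite dotpBr xy subrr.
Qed.

Lemma complex_gt0 (e : R[i]) : 0 < e -> exists2 r : R, 0 < r & e = (r%:C)%C.
Proof.
move=> e0; have eR := RRe_real (gtr0_real e0).
by exists (complex.Re e); rewrite // -ltcR eR.
Qed.

Lemma near_invS_lt (e : R[i]) : 0 < e ->
  \forall k \near \oo, (k.+1%:R^-1 : R[i]) < e.
Proof.
case/complex_gt0 => _/posnumP[r] ->; near=> k.
rewrite -(rmorph_nat (real_complex R)) -fmorphV ltcR.
by near: k; apply: (near_infty_natSinv_lt r).
Unshelve. all: by end_near. Qed.

(** A sequence y_k in M that realizes the distance d to x with squared error
    1/(k+1)^2 has x - y_k orthogonal to M up to 1/(k+1).  This estimate makes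
    the sequence Cauchy, since |y_k - y_l|^2 is the inner product of y_k - y_l
    with (x - y_l) - (x - y_k), and its limit is the projection of x. *)
Lemma closed_ortho_decomp M x : closed_subspace M ->
  exists2 y, M y & ortho_compl M (x - y).
Proof.
case=> Mcl M0 Mlin.
have MB y z : M y -> M z -> M (y - z).
  by move=> My Mz; rewrite addrC -scaleN1r; apply: Mlin.
pose q y : R := complex.Re (dotp (x - y) (x - y)).
have qE y : dotp (x - y) (x - y) = ((q y)%:C)%C.
  by rewrite RRe_real // ger0_real // dotpp_ge0.
have q0 y : 0 <= q y by rewrite -ler0c -qE dotpp_ge0.
pose D := [set q y | y in M]; pose d := inf D.
have Dlb : has_lbound D by exists 0 => _ [y _ <-].
have Dinf : has_inf D by split=> //; exists (q 0); exists 0.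
have dq y : M y -> d <= q y by move=> My; apply: ge_inf => //; exists y.
(* The error is a square so that no square root shows up in key. *)
have ex k : exists y, M y /\ q y < d + k.+1%:R^-1 ^+ 2.
  have k0 : 0 < k.+1%:R^-1 ^+ 2 :> R by rewrite exprn_gt0 // invr_gt0.
  have [_ [y My <-] qy] := inf_adherent k0 Dinf.
  by exists y.
have [y_ /all_and2 [My qy]] := choice ex.
(* Moving y_ k along z within M cannot lower the distance below its infimum. *)
have key k z : M z -> `|dotp (x - y_ k) z| <= k.+1%:R^-1 * `|z|.
  move=> Mz; have [->|z0] := eqVneq z 0.
    by rewrite dotp0r normr0 normr0 mulr0.
  have iz : 0 < dotp z z by rewrite lt_def dotpp_eq0 z0 dotpp_ge0.
  rewrite -ler_sqr ?nnegrE ?mulr_ge0 // exprMn -dotpp -ler_pdivrMr //.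
  set v := x - y_ k; pose a := dotp v z / dotp z z.
  have aE : dotp (x - (y_ k + a *: z)) (x - (y_ k + a *: z)) =
      dotp v v - `|dotp v z| ^+ 2 / dotp z z.
    by rewrite opprD addrA; apply: dot_pythagoras.
  have Mk : M (y_ k + a *: z) by rewrite addrC; apply: Mlin.
  have := dq _ Mk; rewrite -lecR -qE aE lerBrDl.
  have := qy k; rewrite -ltcR -qE -/v => /ltW vd.
  rewrite -lerBrDr => /le_trans; apply.
  rewrite lerBlDr; apply: le_trans vd _.
  by rewrite rmorphD /= rmorphXn fmorphV rmorph_nat addrC.
have yy k l : `|y_ k - y_ l| <= k.+1%:R^-1 + l.+1%:R^-1.
  have [->|z0] := eqVneq (y_ k - y_ l) 0.
    by rewrite normr0 addr_ge0 ?invr_ge0.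
  rewrite -(@ler_pM2r _ `|y_ k - y_ l|) ?normr_gt0 // -expr2 -dotpp.
  have zE : y_ k - y_ l = (x - y_ l) - (x - y_ k).
    by rewrite opprB [RHS]addrC subrKA.
  rewrite -[leLHS]ger0_norm ?dotpp_ge0 // {1}zE.
  rewrite dotpBl; apply: le_trans (ler_normB _ _) _.
  by rewrite addrC mulrDl lerD // key //; apply: MB.
have : cauchy (y_ @ \oo).
  apply: cauchy_exP => e e0.
  have [N _ Ne] := near_invS_lt (divr_gt0 e0 (ltr0n _ 2)).
  exists (y_ N), N => // k /= Nk; rewrite -ball_normE /=.
  apply: le_lt_trans (yy _ _) _; rewrite [ltRHS]splitr ltrD //; apply: Ne => //=.
move/cauchy_cvg/cvg_ex => [y yE]; exists y.
  by apply: (closed_cvg _ Mcl _ _ yE); apply: nearW.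
move=> z Mz; rewrite -/(dotp _ _) dotpC; apply/eqP; rewrite conjC_eq0; apply/eqP.
apply: (@norm_small_eq0 _ _ (`|z| + `|z|)) => [|e e0]; first by rewrite addr_ge0.
near \oo => k.
have -> : x - y = (x - y_ k) - (y - y_ k) by rewrite opprB addrC subrKA addrC.
rewrite dotpBl mulrDr; apply: le_trans (ler_normB _ _) _; apply: lerD.
  apply: le_trans (key _ _ Mz) _; rewrite ler_wpM2r // ltW //.
  by near: k; apply: near_invS_lt.
apply: le_trans (dotp_norm _ _) _; rewrite ler_wpM2r // ltW //.
by near: k; move/cvgrPdist_lt: yE; apply.
Unshelve. all: by end_near. Qed.

Lemma ortho_compl0_setT M : closed_subspace M ->
  (forall y, ortho_compl M y -> y = 0) -> M = setT.
Proof.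
move=> Mcl M0; apply/seteqP; split=> // x _.
have [y My /M0/eqP] := closed_ortho_decomp x Mcl.
by rewrite subr_eq0 => /eqP ->.
Qed.

(** A nonzero functional is determined, up to a factor, by a vector orthogonal to
    its kernel. *)
Lemma riesz (f : H -> R[i]) (c : R[i]) : scalar f ->
  (forall x, `|f x| <= c * `|x|) -> exists z, forall x, f x = dotp x z.
Proof.
move=> lin fc.
have fB x y : f (x - y) = f x - f y.
  by rewrite -scaleN1r addrC lin mulN1r addrC.
have f0 : f 0 = 0 by rewrite -(subrr 0) fB subrr.
have kcl : closed_subspace [set x | f x = 0].
  pose g : {linear H -> R[i]^o} := HB.pack f
    (GRing.isLinear.Build R[i] H R[i]^o _ _ lin).
  split; [exact: (@closed_linear_ker _ _ _ g c)|by []|].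
  by move=> a x y /= fx fy; rewrite lin fx fy mulr0 addr0.
have [fz|/existsNP [x0 fx0]] := pselect (forall x, f x = 0).
  by exists 0 => x; rewrite fz dotp0r.
have [y fy oy] := closed_ortho_decomp x0 kcl.
pose v := x0 - y; have fv : f v != 0.
  by rewrite fB fy subr0; apply/eqP.
have v0 : dotp v v != 0.
  by rewrite dotpp_eq0; apply: contraNneq fv => ->; rewrite f0.
exists ((f v / dotp v v)^* *: v) => x; rewrite dotpZr conjCK.
have /oy : [set x | f x = 0] (x - (f x / f v) *: v).
  by rewrite /= fB -[_ *: _]addr0 lin f0 addr0 divfK ?subrr.
rewrite -/(dotp _ _) dotpBl dotpZl => /eqP; rewrite subr_eq0 => /eqP ->.
by rewrite -/v; field; rewrite fv v0.
Qed.

End HilbertSpace.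

Section Adjoint.
Context (R : realType) (H K : hilbertType R).

Lemma dotp_adjoint (A : bounded_op H K) x y :
  dotp (A x) y = dotp x (adjoint A y).
Proof.
suff : [set z | forall x, dotp (A x) y = dotp x z] (adjoint A y).
  exact.
apply: xgetPex.
have [c Ac] := bounded_opP A.
apply: (@riesz _ _ (fun x => dotp (A x) y) (c * `|y|)) => [a x1 z|x1].
  by rewrite linearP dotpDl dotpZl.
by rewrite mulrAC; apply: le_trans (dotp_norm _ _) _; rewrite ler_wpM2r.
Qed.

Lemma adjoint_unique (A : bounded_op H K) y z :
  (forall x, dotp (A x) y = dotp x z) -> adjoint A y = z.
Proof. by move=> Az; apply: eq_of_dotp => x; rewrite -dotp_adjoint. Qed.

Lemma dotp_adjointr (A : bounded_op H K) x y :
  dotp y (A x) = dotp (adjoint A y) x.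
Proof. by rewrite dotpC dotp_adjoint -dotpC. Qed.

Lemma adjointP (A : bounded_op H K) a x y :
  adjoint A (a *: x + y) = a *: adjoint A x + adjoint A y.
Proof.
apply: adjoint_unique => z.
by rewrite !dotpDr !dotpZr !dotp_adjoint.
Qed.

Lemma bounded_op_ge0 (A : bounded_op H K) :
  exists2 b : R[i], 0 <= b & forall x, `|A x| <= b * `|x|.
Proof.
have [b Ab] := bounded_opP A; exists `|b| => // x.
have [->|x0] := eqVneq x 0; first by rewrite linear0 !normr0 mulr0.
apply: le_trans (Ab x) _; rewrite ler_wpM2r //.
by rewrite ger0_norm // -(@pmulr_lge0 _ `|x|) ?normr_gt0 // (le_trans _ (Ab x)).
Qed.

Lemma norm_adjoint_le (A : bounded_op H K) b y : 0 <= b ->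
  (forall x, `|A x| <= b * `|x|) -> `|adjoint A y| <= b * `|y|.
Proof.
move=> b0 Ab; have [->|y0] := eqVneq (adjoint A y) 0.
  by rewrite normr0 mulr_ge0.
rewrite -(@ler_pM2r _ `|adjoint A y|) ?normr_gt0 // -expr2 -dotpp -dotp_adjoint.
apply: le_trans (real_ler_norm _) _.
  by rewrite dotp_adjoint dotpp realX // normr_real.
apply: le_trans (dotp_norm _ _) _.
by rewrite mulrAC ler_wpM2r // Ab.
Qed.

End Adjoint.

Section AdjointOperator.
Context (R : realType) (H K L : hilbertType R).

HB.instance Definition _ (A : bounded_op H K) :=
  GRing.isLinear.Build R[i] K H _ (adjoint A) (adjointP A).

Lemma adjointZ (A : bounded_op H K) a y : adjoint A (a *: y) = a *: adjoint A y.
Proof. exact: linearZ. Qed.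

Fact adj_bounded (A : bounded_op H K) :
  exists b : R[i], forall y, `|adjoint A y| <= b * `|y|.
Proof.
have [b b0 Ab] := bounded_op_ge0 A; exists b => y; exact: norm_adjoint_le.
Qed.

Definition adj_op (A : bounded_op H K) : bounded_op K H :=
  BoundedOp (adj_bounded A).

Lemma adjoint_adj (A : bounded_op H K) x : adjoint (adj_op A) x = A x.
Proof. by apply: adjoint_unique => y; rewrite -dotp_adjointr. Qed.

Fact comp_bounded (A : bounded_op K L) (B : bounded_op H K) :
  exists b : R[i], forall x, `|(A \o B) x| <= b * `|x|.
Proof.
have [a a0 Aa] := bounded_op_ge0 A; have [b b0 Bb] := bounded_op_ge0 B.
exists (a * b) => x; apply: le_trans (Aa _) _.
by rewrite -mulrA ler_wpM2l.
Qed.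

Definition comp_op (A : bounded_op K L) (B : bounded_op H K) : bounded_op H L :=
  BoundedOp (comp_bounded A B).

Lemma adjoint_comp (A : bounded_op K L) (B : bounded_op H K) y :
  adjoint (comp_op A B) y = adjoint B (adjoint A y).
Proof. by apply: adjoint_unique => x; rewrite /= !dotp_adjoint. Qed.

End AdjointOperator.

(** * Limits of complex sequences *)

Lemma cvg_sumr (C : numFieldType) (V : normedModType C) (T I : Type)
    (F : set_system T) {FF : Filter F} (f : I -> T -> V) (l : I -> V)
    (r : seq I) :
  (forall i, f i @ F --> l i) ->
  (fun t => \sum_(i <- r) f i t) @ F --> \sum_(i <- r) l i.
Proof.
move=> fl; elim: r => [|i r IH].
  by rewrite big_nil; under eq_fun do rewrite big_nil; apply: cvg_cst.
by rewrite big_cons; under eq_fun do rewrite big_cons; apply: cvgD.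
Qed.

Section Tends.
Context (C : numClosedFieldType).
Implicit Types (u v : nat -> C) (l : C).

(** A wrapper that keeps convergence from unfolding to a filter inclusion, which
    is a product type. *)
Variant tends u l : Prop := Tends of u @ \oo --> l.

Lemma tendsP u l : (forall e, 0 < e -> exists N, forall k, (N <= k)%N ->
  `|l - u k| < e) <-> tends u l.
Proof.
split=> [ul|[/cvgrPdist_lt ul] e /ul [N _ Nu]].
  by split; apply/cvgrPdist_lt => e /ul[N Nu]; exists N.
by exists N.
Qed.

Lemma tends_unique u l1 l2 : tends u l1 -> tends u l2 -> l1 = l2.
Proof. by move=> [u1] [u2]; apply: (cvg_unique _ u1 u2); apply: norm_hausdorff. Qed.

Lemma tends_cst l : tends (fun=> l) l.
Proof. by split; apply: cvg_cst. Qed.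

Lemma tendsD u v l1 l2 : tends u l1 -> tends v l2 ->
  tends (fun k => u k + v k) (l1 + l2).
Proof. by move=> [ul] [vl]; split; apply: cvgD. Qed.

Lemma tendsM a u l : tends u l -> tends (fun k => a * u k) (a * l).
Proof. by move=> [ul]; split; apply: cvgM => //; apply: cvg_cst. Qed.

Lemma tends_ext u v l : tends u l -> u =1 v -> tends v l.
Proof. by move=> ul /funext <-. Qed.

Lemma tends_sum (I : finType) (u : I -> nat -> C) (l : I -> C) :
  (forall i, tends (u i) (l i)) ->
  tends (fun k => \sum_i u i k) (\sum_i l i).
Proof.
by move=> ul; split; apply: (@cvg_sumr _ C^o) => i; have [] := ul i.
Qed.

Lemma tends_conj u l : tends u l -> tends (fun k => (u k)^*) l^*.
Proof.
move=> /tendsP ul; apply/tendsP => e /ul [N Nu]; exists N => k /Nu.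
by rewrite -rmorphB norm_conjC.
Qed.

Lemma tends_shift u l : tends u l -> tends (fun k => u k.+1) l.
Proof.
move=> /tendsP ul; apply/tendsP => e /ul [N Nu]; exists N => k Nk.
by apply: Nu; apply: leqW.
Qed.

Lemma tends_le u l b : l \is Num.real -> b \is Num.real ->
  tends u l -> (forall k, u k <= b) -> l <= b.
Proof.
move=> lR bR /tendsP ul ub; rewrite real_leNgt //; apply/negP => bl.
have [|N /(_ N (leqnn _)) lu] := ul (l - b); first by rewrite subr_gt0.
have uR : u N \is Num.real by rewrite (ler_real (ub N)).
have := le_lt_trans (real_ler_norm (rpredB lR uR)) lu.
by rewrite ltrD2l ltrN2 => /lt_le_trans /(_ (ub N)); rewrite ltxx.
Qed.

End Tends.

(** The order of R[i] is partial, so that monotone convergence has to go through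
    real parts. *)
Lemma tends_nondecreasing (R : realType) (u : nat -> R[i]) (b : R[i]) :
  (forall k, 0 <= u k) -> (forall k, u k <= u k.+1) -> (forall k, u k <= b) ->
  exists2 l, tends u l & forall k, u k <= l.
Proof.
move=> u0 uS ub; pose v k : R := complex.Re (u k).
have uE k : u k = ((v k)%:C)%C by rewrite RRe_real // ger0_real.
have b0 : 0 <= b by apply: le_trans (ub 0%N).
have bE : b = ((complex.Re b)%:C)%C by rewrite RRe_real // ger0_real.
have vS : nondecreasing_seq v.
  by apply/nondecreasing_seqP => k; rewrite -lecR -!uE.
have vcvg : cvgn v.
  apply: nondecreasing_is_cvgn => //; exists (complex.Re b) => _ [k _ <-].
  by rewrite -lecR -uE -bE.
exists (((limn v)%:C)%C); last first.
  by move=> k; rewrite uE lecR; apply: nondecreasing_cvgn_le.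
apply/tendsP => _ /complex_gt0 [e e0 ->].
move/cvgrPdist_lt: vcvg => /(_ e e0) [N _ Nv]; exists N => k /Nv.
rewrite uE -rmorphB /= -ltcR => /le_lt_trans; apply.
by rewrite normc_def /= expr0n addr0 sqrtr_sqr.
Qed.

(** * Level sums of functions on words *)

Section Levels.
Context (R : realType) (H : hilbertType R) (I : finType).
Implicit Types (x y z : seq I -> H) (k : nat).

Definition shift (a : I) x : seq I -> H := fun w => x (a :: w).

(** The sum of the inner products of x w and y w over the words w of length k,
    arranged by first letter so that it can be computed by induction on k. *)
Fixpoint lev k x y : R[i] :=
  if k is k'.+1 then \sum_a lev k' (shift a x) (shift a y)
  else dotp (x [::]) (y [::]).

Lemma levP k a x y z :
  lev k (fun w => a *: x w + y w) z = a * lev k x z + lev k y z.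
Proof.
elim: k x y z => [|k IH] x y z /=; first by rewrite dotpDl dotpZl.
by rewrite mulr_sumr -big_split; apply: eq_bigr => b _; apply: (IH (shift b x)).
Qed.

Lemma levC k x y : lev k x y = (lev k y x)^*.
Proof.
elim: k x y => [|k IH] x y /=; first exact: dotpC.
by rewrite rmorph_sum; apply: eq_bigr => b _; apply: IH.
Qed.

Lemma levPr k a x y z :
  lev k z (fun w => a *: x w + y w) = a^* * lev k z x + lev k z y.
Proof. by rewrite levC levP rmorphD rmorphM /= -!levC. Qed.

Lemma levZ k a x :
  lev k (fun w => a *: x w) (fun w => a *: x w) = a * a^* * lev k x x.
Proof.
elim: k x => [|k IH] x /=; first by rewrite dotpZl dotpZr mulrA.
by rewrite mulr_sumr; apply: eq_bigr => b _; apply: (IH (shift b x)).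
Qed.

Lemma lev0l k x : lev k (fun=> 0) x = 0.
Proof.
elim: k x => [|k IH] x /=; first by rewrite dotp0l.
by rewrite big1 // => a _; apply: IH.
Qed.

Lemma lev_ge0 k x : 0 <= lev k x x.
Proof.
elim: k x => [|k IH] x /=; first exact: dotpp_ge0.
by apply: sumr_ge0.
Qed.

Lemma lev_coord x (w : seq I) : `|x w| ^+ 2 <= lev (size w) x x.
Proof.
elim: w x => [|a w IH] x /=; first by rewrite dotpp.
apply: le_trans (IH (shift a x)) _.
by rewrite (bigD1 a) //= lerDl sumr_ge0 // => b _; apply: lev_ge0.
Qed.

(** Polarization reduces convergence of all level sums to that of the monotone
    sequences [lev k x x]. *)
Lemma lev_polarization k x y : 4%:R * lev k x y =
  lev k (fun w => x w + y w) (fun w => x w + y w)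
  - lev k (fun w => x w - y w) (fun w => x w - y w)
  + 'i * lev k (fun w => x w + 'i *: y w) (fun w => x w + 'i *: y w)
  - 'i * lev k (fun w => x w - 'i *: y w) (fun w => x w - 'i *: y w).
Proof.
have E a x' : x' = (fun w => x w + a *: y w) -> lev k x' x' =
    lev k x x + a * lev k y x + a^* * lev k x y + a * a^* * lev k y y.
  have -> : (fun w => x w + a *: y w) = (fun w => a *: y w + x w).
    by apply/funext => w; rewrite addrC.
  by move=> ->; rewrite levP !levPr; ring.
rewrite (E 1 (fun w => x w + y w)); last by apply/funext => w; rewrite scale1r.
rewrite (E (-1) (fun w => x w - y w)); last first.
  by apply/funext => w; rewrite scaleN1r.
rewrite (E 'i (fun w => x w + 'i *: y w)) //.
rewrite (E (- 'i) (fun w => x w - 'i *: y w)); last first.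
  by apply/funext => w; rewrite scaleNr.
rewrite !rmorphN rmorph1 /= conjCi.
have ii : 'i * 'i = -1 :> R[i] by rewrite -expr2 sqrCi.
ring: ii.
Qed.

Lemma lev_le_parallelogram k x y :
  lev k (fun w => x w + y w) (fun w => x w + y w) <=
  2%:R * (lev k x x + lev k y y).
Proof.
rewrite -subr_ge0; have := lev_ge0 k (fun w => - 1 *: x w + y w).
have -> : (fun w => x w + y w) = (fun w => 1 *: x w + y w).
  by apply/funext => w; rewrite scale1r.
rewrite !levP !levPr rmorphN rmorph1 => xy.
by apply: le_trans xy _; rewrite le_eqVlt; apply/orP; left; apply/eqP; ring.
Qed.

(** The inner products of z b and z c occur with the total coefficient
    sum_a v_(a,b) conj(v_(a,c)), so that the cross terms cancel. *)
Lemma lev_unitary (A B : finType) (v : A -> B -> R[i]) k (z : B -> seq I -> H) :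
  (forall b c, \sum_a v a b * (v a c)^* = (b == c)%:R) ->
  \sum_a lev k (fun w => \sum_b v a b *: z b w) (fun w => \sum_b v a b *: z b w)
  = \sum_b lev k (z b) (z b).
Proof.
move=> vv; elim: k z => [|k IH] z /=; last first.
  rewrite exchange_big [RHS]exchange_big; apply: eq_bigr => a _ /=.
  exact: (IH (fun b => shift a (z b))).
have E a : dotp (\sum_b v a b *: z b [::]) (\sum_b v a b *: z b [::]) =
    \sum_b \sum_c v a b * (v a c)^* * dotp (z b [::]) (z c [::]).
  rewrite dotp_suml; apply: eq_bigr => b _.
  rewrite dotpZl dotp_sumr mulr_sumr; apply: eq_bigr => c _.
  by rewrite dotpZr mulrA.
rewrite (eq_bigr _ (fun a _ => E a)).
rewrite exchange_big; apply: eq_bigr => b _ /=.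
rewrite exchange_big /= (bigD1 b) //= -mulr_suml vv eqxx mul1r.
rewrite big1 ?addr0 // => c cb.
by rewrite -mulr_suml vv eq_sym (negPf cb) mul0r.
Qed.

(** Each entry of a row contraction is a contraction: apply the row to a family
    with a single nonzero member. *)
Lemma lev_row_entry (J : finType)
    (L : J -> {linear (seq I -> H) -> (seq I -> H)}) :
  (forall k (x : J -> seq I -> H),
     lev k (fun w => \sum_j L j (x j) w) (fun w => \sum_j L j (x j) w)
     <= \sum_j lev k (x j) (x j)) ->
  forall j k x, lev k (L j x) (L j x) <= lev k x x.
Proof.
move=> Lle j k x; have := Lle k (fun i => if i == j then x else 0).
have -> : (fun w => \sum_i L i (if i == j then x else 0) w) = L j x.
  apply/funext => w; rewrite (bigD1 j) //= eqxx big1 ?addr0 //.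
  by move=> i /negPf ->; rewrite linear0.
rewrite (bigD1 j) //= eqxx [X in _ + X]big1 ?addr0 // => i /negPf ->.
exact: lev0l.
Qed.

End Levels.

Lemma dotp_polarization (R : realType) (H : hilbertType R) (h g : H) :
  4%:R * dotp h g =
  `|h + g| ^+ 2 - `|h - g| ^+ 2 + 'i * `|h + 'i *: g| ^+ 2
  - 'i * `|h - 'i *: g| ^+ 2.
Proof.
by have := @lev_polarization _ _ void 0 (fun=> h) (fun=> g); rewrite /= !dotpp.
Qed.

Lemma norm_unitary (R : realType) (H : hilbertType R) (A B : finType)
    (v : A -> B -> R[i]) (z : B -> H) :
  (forall b c, \sum_a v a b * (v a c)^* = (b == c)%:R) ->
  \sum_a `|\sum_b v a b *: z b| ^+ 2 = \sum_b `|z b| ^+ 2.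
Proof.
move=> /(@lev_unitary _ _ void _ _ v 0 (fun b => fun=> z b)) /= vz.
have := vz; rewrite (eq_bigr _ (fun a _ => dotpp _)) => ->.
by apply: eq_bigr => b _; rewrite dotpp.
Qed.

(** * The Hilbert space of bounded harmonic functions *)

Record row_contraction (R : realType) (H : hilbertType R) (I : finType) :=
  RowContraction {
    rc_op :> I -> bounded_op H H ;
    rc_le : forall z : I -> H,
      `|\sum_a rc_op a (z a)| ^+ 2 <= \sum_a `|z a| ^+ 2
  }.

Section Model.
Context (R : realType) (H : hilbertType R) (I : finType)
  (c : row_contraction H I).
Implicit Types (x y z : seq I -> H) (k : nat).

(** The relation satisfied by the coordinates of a vector in a dilation of c to a
    row unitary; it is a mean value property along the tree of words. *)
Definition harmonic x := forall w, x w = \sum_a c a (x (rcons w a)).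

Definition bounded_levels x := exists b : R[i], forall k, lev k x x <= b.

Lemma harmonic_shift a x : harmonic x -> harmonic (shift a x).
Proof. by move=> hx w; rewrite /shift hx. Qed.

Lemma harmonicP a x y : harmonic x -> harmonic y ->
  harmonic (fun w => a *: x w + y w).
Proof.
move=> hx hy w; rewrite hx hy scaler_sumr -big_split.
by apply: eq_bigr => b _; rewrite linearP.
Qed.

(** By the mean value property the values at words of length k are images under
    the row contraction of the values at length k+1. *)
Lemma lev_le_succ k x : harmonic x -> lev k x x <= lev k.+1 x x.
Proof.
elim: k x => [|k IH] x hx.
  rewrite /= dotpp hx; apply: le_trans (rc_le _ _) _.
  by apply: ler_sum => a _; rewrite dotpp.
by apply: ler_sum => a _; apply/IH/harmonic_shift.
Qed.

Lemma bounded_levelsP a x y : bounded_levels x -> bounded_levels y ->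
  bounded_levels (fun w => a *: x w + y w).
Proof.
move=> [b xb] [d yd]; exists (2%:R * (a * a^* * b + d)) => k.
apply: le_trans (lev_le_parallelogram k (fun w => a *: x w) y) _.
rewrite ler_wpM2l // lerD //.
by rewrite levZ ler_wpM2l // -normCK exprn_ge0.
Qed.

Lemma lev_cvg x y : harmonic x -> bounded_levels x ->
  harmonic y -> bounded_levels y -> exists l, tends (fun k => lev k x y) l.
Proof.
move=> hx bx hy by_.
have q z : harmonic z -> bounded_levels z ->
    exists l, tends (fun k => lev k z z) l.
  move=> hz [b zb]; have [||l zl _] := @tends_nondecreasing _ _ b _ _ zb.
  - by move=> k; apply: lev_ge0.
  - by move=> k; apply: lev_le_succ.
  by exists l.
have qa a z : z = (fun w => a *: y w + x w) ->
    exists l, tends (fun k => lev k z z) l.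
  by move=> ->; apply: q; [apply: harmonicP|apply: bounded_levelsP].
have [|l1 t1] := qa 1 (fun w => x w + y w).
  by apply/funext => w; rewrite scale1r addrC.
have [|l2 t2] := qa (-1) (fun w => x w - y w).
  by apply/funext => w; rewrite scaleN1r addrC.
have [|l3 t3] := qa 'i (fun w => x w + 'i *: y w).
  by apply/funext => w; rewrite addrC.
have [|l4 t4] := qa (- 'i) (fun w => x w - 'i *: y w).
  by apply/funext => w; rewrite scaleNr addrC.
exists (4%:R^-1 * (l1 + -1 * l2 + 'i * l3 + - 'i * l4)).
have := tendsM 4%:R^-1 (tendsD (tendsD (tendsD t1 (tendsM (-1) t2))
  (tendsM 'i t3)) (tendsM (- 'i) t4)).
move/tends_ext; apply => k.
by rewrite mulN1r mulNr -lev_polarization mulrA mulVf ?mul1r // pnatr_eq0.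
Qed.

End Model.

Section ModelSpace.
Context (R : realType) (H : hilbertType R) (I : finType)
  (c : row_contraction H I).

Definition in_model : {pred seq I -> H} :=
  fun x => `[< harmonic c x /\ bounded_levels x >].

Fact in_model_submod : submod_closed in_model.
Proof.
split=> [|a x y /asboolP[hx bx] /asboolP[hy by_]]; apply/asboolP.
  split=> [w|]; first by rewrite big1 // => a _; rewrite linear0.
  by exists 0 => k; rewrite lev0l.
by split; [apply: harmonicP|apply: bounded_levelsP].
Qed.
HB.instance Definition _ :=
  GRing.isSubmodClosed.Build R[i] (seq I -> H) in_model in_model_submod.

Record model := Model { mval :> seq I -> H ; _ : mval \in in_model }.
HB.instance Definition _ := [isSub for mval].
HB.instance Definition _ := [Choice of model by <:].
HB.instance Definition _ := [SubChoice_isSubLmodule of model by <:].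

Lemma mval_harmonic (x : model) : harmonic c x.
Proof. by case: x => x /= /asboolP[]. Qed.

Lemma mval_bounded (x : model) : bounded_levels x.
Proof. by case: x => x /= /asboolP[]. Qed.

Lemma mval_inj (x y : model) : (forall w, x w = y w) -> x = y.
Proof. by move=> xy; apply/val_inj/funext. Qed.

(** The limit of the level sums; it exists by [lev_cvg], so the default value 0
    is never taken. *)
Definition mdot (x y : model) : R[i] :=
  xget 0 [set l | tends (fun k => lev k x y) l].

Lemma mdot_tends (x y : model) : tends (fun k => lev k x y) (mdot x y).
Proof.
rewrite /mdot; case: xgetP => [l _ //|/= none].
have [l xyl] := lev_cvg (mval_harmonic x) (mval_bounded x) (mval_harmonic y)
  (mval_bounded y).
by case: (none l).
Qed.

Lemma mdotE (x y : model) l : tends (fun k => lev k x y) l -> mdot x y = l.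
Proof. exact/tends_unique/mdot_tends. Qed.

Lemma lev_le_mdot k (x : model) : lev k x x <= mdot x x.
Proof.
have [b xb] := mval_bounded x.
have [||l xl kl] := @tends_nondecreasing _ _ b _ _ xb.
- by move=> j; apply: lev_ge0.
- by move=> j; apply/lev_le_succ/mval_harmonic.
by rewrite (mdotE xl).
Qed.

Lemma mdot_le (x : model) b : 0 <= b -> (forall k, lev k x x <= b) ->
  mdot x x <= b.
Proof.
move=> b0 xb; apply: tends_le (mdot_tends x x) xb; last by rewrite ger0_real.
by rewrite ger0_real // (le_trans _ (lev_le_mdot 0 x)) // lev_ge0.
Qed.

Fact mdot_bilinear : bilinear_for *%R ((@Num.conj R[i]) \; *%R) mdot.
Proof.
split=> [z a x y|z a x y].
  apply: mdotE; apply: tends_ext (tendsD (tendsM a (mdot_tends x z))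
    (mdot_tends y z)) _ => k; exact/esym/levP.
apply: mdotE; apply: tends_ext (tendsD (tendsM a^* (mdot_tends z x))
  (mdot_tends z y)) _ => k; exact/esym/levPr.
Qed.
HB.instance Definition _ := bilinear_isBilinear.Build R[i] model model R[i]
  _ _ mdot mdot_bilinear.

Fact mdot_hermitian x y : mdot x y = (-1) ^+ false * (mdot y x)^*.
Proof.
rewrite expr0 mul1r; apply: mdotE.
by apply: tends_ext (tends_conj (mdot_tends y x)) _ => k; apply/esym/levC.
Qed.
HB.instance Definition _ := isHermitianSesquilinear.Build R[i] model false
  (@Num.conj R[i]) mdot mdot_hermitian.

Lemma coord_le_mdot (x : model) w : `|x w| ^+ 2 <= mdot x x.
Proof. exact: le_trans (lev_coord x w) (lev_le_mdot _ _). Qed.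

Fact mdot_gt0 (x : model) : x != 0 -> 0 < mdot x x.
Proof.
move=> x0; rewrite lt_def (le_trans _ (lev_le_mdot 0 x)) ?lev_ge0 // andbT.
apply: contraNneq x0 => xx; apply/eqP/mval_inj => w; apply/eqP.
change (x w == 0); rewrite -normr_eq0 -sqrf_eq0 eq_le exprn_ge0 // andbT.
by rewrite -xx coord_le_mdot.
Qed.
HB.instance Definition _ := isDotProduct.Build R[i] model mdot mdot_gt0.

Definition mnorm (x : model) : R[i] := sqrtC (mdot x x).

Fact mnormD x y : mnorm (x + y) <= mnorm x + mnorm y.
Proof. exact: dot_triangle. Qed.

Fact mnormZ a x : mnorm (a *: x) = `|a| * mnorm x.
Proof.
rewrite /mnorm dnormZ sqrtCM ?nnegrE ?exprn_ge0 ?dnorm_ge0 //.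
by rewrite sqrCK.
Qed.

Fact mnorm_eq0 x : mnorm x = 0 -> x = 0.
Proof. by move/eqP; rewrite sqrt_dnorm_eq0 => /eqP. Qed.

HB.instance Definition _ := Lmodule_isNormed.Build R[i] model
  mnormD mnormZ mnorm_eq0.

Lemma mnormE (x : model) : `|x| ^+ 2 = mdot x x.
Proof. by rewrite -[`|x|]/(mnorm x) sqrtCK. Qed.

End ModelSpace.

(** Pointwise convergence to 0 gives convergence at each level, which consists
    of finitely many words. *)
Lemma lev_near0 (R : realType) (H : hilbertType R) (I : finType)
    (T : Type) (F : set_system T) {FF : Filter F} (g : T -> seq I -> H) k :
  (forall w, (fun t => g t w) @ F --> (0 : H)) ->
  forall e : R[i], 0 < e -> \forall t \near F, lev k (g t) (g t) < e.
Proof.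
elim: k g => [|k IH] g g0 e e0 /=.
  have se : 0 < sqrtC e by rewrite sqrtC_gt0.
  have /cvgr0Pnorm_lt/(_ _ se) := g0 [::]; apply: filterS => t gt.
  by rewrite dotpp -(sqrtCK e) ltr_pXn2r // ?nnegrE ?(ltW se).
have d0 : 0 < e / #|I|.+1%:R by rewrite divr_gt0.
have : \forall t \near F, forall a, lev k (shift a (g t)) (shift a (g t)) <
    e / #|I|.+1%:R.
  by apply: filter_forall => a; apply: IH => // w; apply: g0.
apply: filterS => t gt; apply: (@le_lt_trans _ _ (\sum_(a : I) e / #|I|.+1%:R)).
  by apply: ler_sum => a _; apply: ltW.
rewrite sumr_const -[X in X < _]mulr_natr -mulrA gtr_pMr //.
by rewrite mulrC ltr_pdivrMr // mul1r ltr_nat.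
Qed.

Section ModelComplete.
Context (R : realType) (H : hilbertType R) (I : finType)
  (c : row_contraction H I).

Lemma coord_le_norm (x : model c) w : `|x w| <= `|x|.
Proof. by rewrite -ler_sqr ?nnegrE // mnormE coord_le_mdot. Qed.

(** A Cauchy filter converges at each word.  To compare the limit l with an
    element x at a given level, pass through an element y of the filter that is
    close to l at that level: the parallelogram inequality costs a factor 2
    that does not depend on the level. *)
Fact model_complete (F : set_system (model c)) :
  ProperFilter F -> cauchy F -> cvg F.
Proof.
move=> FF /cauchy_ballP Fc.
have {}Fc e : 0 < e -> \forall x \near F, \forall y \near F, `|x - y| < e.
  move=> /Fc; rewrite -ball_normE => xy; exact: nearP_dep.
have coord w : exists l : H, (fun x : model c => x w) @ F --> l.
  have : cauchy ((fun x : model c => x w) @ F).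
    apply: cauchy_exP => e /Fc /filter_ex[x xe]; exists (x w).
    rewrite -ball_normE /=; apply: filterS xe => y; apply: le_lt_trans.
    exact: (coord_le_norm (x - y)).
  by move/cauchy_cvg/cvg_ex.
have [l xl] := choice coord.
have lx0 w : (fun y : model c => l w - y w) @ F --> (0 : H).
  by rewrite -(subrr (l w)); apply: cvgB => //; apply: cvg_cst.
have lx e (x : model c) k : 0 < e -> (\forall y \near F, `|x - y| < e) ->
    lev k (fun w => l w - x w) (fun w => l w - x w) <= 4%:R * e ^+ 2.
  move=> e0 xe; have e2 : 0 < e ^+ 2 by rewrite exprn_gt0.
  near F => y.
  have xy : `|x - y| < e by near: y.
  have ly : lev k (fun w => l w - y w) (fun w => l w - y w) < e ^+ 2.
    by near: y; apply: lev_near0.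
  have -> : (fun w => l w - x w) = (fun w => (l w - y w) + (y - x) w).
    by apply/funext => w; rewrite /= addrA subrK.
  apply: le_trans (lev_le_parallelogram k _ _) _.
  have -> : 4%:R * e ^+ 2 = 2%:R * (e ^+ 2 + e ^+ 2) by ring.
  rewrite ler_wpM2l // lerD ?ltW //.
  apply: le_lt_trans (lev_le_mdot k (y - x)) _; rewrite -mnormE distrC.
  by rewrite ltr_pXn2r // ?nnegrE ?(ltW e0).
have hl : harmonic c l.
  move=> w; apply: (cvg_unique _ (xl w)); first exact: norm_hausdorff.
  have -> : (fun x : model c => x w) = (fun x => \sum_a c a (x (rcons w a))).
    by apply/funext => x; apply: mval_harmonic.
  apply: cvg_sumr => a.
  have [d cd] := bounded_opP (c a).
  apply: continuous_cvg; last exact: xl.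
  exact: (linear_le_continuous cd).
have bl : bounded_levels l.
  have /filter_ex[x x1] := Fc 1 ltr01.
  exists (2%:R * (4%:R * 1 ^+ 2 + mdot x x)) => k.
  have -> : l = (fun w => (l w - x w) + x w).
    by apply/funext => w; rewrite subrK.
  apply: le_trans (lev_le_parallelogram k _ _) _.
  by rewrite ler_wpM2l // lerD ?lx // lev_le_mdot.
have lK : l \in in_model c by apply/asboolP.
apply/cvg_ex; exists (Model lK); apply/cvgrPdist_le => e e0.
have e2 : 0 < e / 2%:R by rewrite divr_gt0.
apply: filterS (Fc _ e2) => x xe.
rewrite -ler_sqr ?nnegrE ?(ltW e0) // mnormE.
apply: mdot_le => [|k]; first by rewrite exprn_ge0 // ltW.
apply: le_trans (lx _ _ k e2 xe) _; rewrite le_eqVlt; apply/orP; left; apply/eqP.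
by field.
Unshelve. all: by end_near. Qed.
HB.instance Definition _ := Uniform_isComplete.Build (model c) model_complete.

Fact model_innerE (x : model c) : mdot x x = `|x| ^+ 2.
Proof. by rewrite mnormE. Qed.
HB.instance Definition _ := CompleteNormedModule_isHilbert.Build R (model c)
  model_innerE.

Definition modelH : hilbertType R := model c.

End ModelComplete.

(** * Operators on harmonic functions, and the embedding of H *)

Section ModelOperators.
Context (R : realType) (H : hilbertType R) (I : finType)
  (c : row_contraction H I).
Local Notation K := (modelH c).

Lemma mval_sum (J : Type) (r : seq J) (P : pred J) (y : J -> model c) w :
  (\sum_(j <- r | P j) y j : model c) w = \sum_(j <- r | P j) y j w.
Proof. by elim/big_rec2: _ => [|j _ x _ <-]. Qed.

Fact mshift_subproof a (x : model c) : shift a x \in in_model c.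
Proof.
apply/asboolP; split; first exact/harmonic_shift/mval_harmonic.
have [b xb] := mval_bounded x; exists b => k.
apply: le_trans (xb k.+1); rewrite /= (bigD1 a) //= lerDl.
by rewrite sumr_ge0 // => d _; apply: lev_ge0.
Qed.

Definition mshift a (x : model c) : model c := Model (mshift_subproof a x).

(** The shifts are the adjoints W_a^* of a row unitary; this is the identity
    W W^* = 1. *)
Lemma mdot_shift (x y : model c) :
  mdot x y = \sum_a mdot (mshift a x) (mshift a y).
Proof.
apply: tends_unique (tends_shift (mdot_tends x y)) _.
apply: (tends_sum (u := fun a k => lev k (shift a x) (shift a y))) => a.
exact: (mdot_tends (mshift a x) (mshift a y)).
Qed.

Section Lift.
Context (L : {linear (seq I -> H) -> (seq I -> H)}).
Context (Lh : forall x, harmonic c x -> harmonic c (L x)).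
Context (Lle : forall k x, lev k (L x) (L x) <= lev k x x).

Fact model_op_subproof (x : model c) : L x \in in_model c.
Proof.
apply/asboolP; split; first exact/Lh/mval_harmonic.
by have [b xb] := mval_bounded x; exists b => k; apply: le_trans (xb k).
Qed.

Definition model_map (x : K) : K := Model (model_op_subproof x).

Fact model_map_linear : linear model_map.
Proof. by move=> a x y; apply/val_inj; rewrite /= linearP. Qed.
HB.instance Definition _ := GRing.isLinear.Build R[i] K K _ model_map
  model_map_linear.

Lemma model_map_le (x : K) : `|model_map x| <= `|x|.
Proof.
rewrite -ler_sqr ?nnegrE // !mnormE.
apply: mdot_le => [|k]; first by rewrite -mnormE exprn_ge0.
exact: le_trans (Lle k x) (lev_le_mdot k x).
Qed.

Fact model_map_bounded : exists b : R[i], forall x : K, `|model_map x| <= b * `|x|.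
Proof. by exists 1 => x; rewrite mul1r model_map_le. Qed.

Definition model_op : bounded_op K K := BoundedOp model_map_bounded.

End Lift.

Section Embedding.
Context (hc : forall h, \sum_a c a (adjoint (c a) h) = h).

(** The function w |-> c_w^* h: the coordinates that h itself has in any
    dilation for which H is invariant under the adjoints. *)
Definition orbit (h : H) (w : seq I) : H :=
  foldl (fun y a => adjoint (c a) y) h w.

Lemma orbit_harmonic h : harmonic c (orbit h).
Proof.
move=> w; under eq_bigr do rewrite /orbit foldl_rcons.
by rewrite hc.
Qed.

(** The level sums against an orbit do not depend on the level; so the embedding
    is isometric and its adjoint is evaluation at the empty word. *)
Lemma lev_orbit k h x : harmonic c x -> lev k (orbit h) x = dotp h (x [::]).
Proof.
elim: k h x => [//|k IH] h x hx /=; rewrite [in RHS]hx dotp_sumr.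
apply: eq_bigr => a _; by rewrite dotp_adjointr IH //; apply: harmonic_shift.
Qed.

Fact orbit_in_model h : orbit h \in in_model c.
Proof.
apply/asboolP; split; first exact: orbit_harmonic.
by exists (dotp h h) => k; rewrite lev_orbit //; apply: orbit_harmonic.
Qed.

Definition embed_map (h : H) : K := Model (orbit_in_model h).

Fact embed_linear : linear embed_map.
Proof.
move=> a x y; apply/mval_inj => w; rewrite -[RHS]/(a *: orbit x w + orbit y w) /=.
by elim: w x y => //= b w IH x y; rewrite adjointP IH.
Qed.
HB.instance Definition _ := GRing.isLinear.Build R[i] H K _ embed_map
  embed_linear.

Lemma mdot_embed h (x : K) : mdot (embed_map h) x = dotp h (x [::]).
Proof.
apply: mdotE; apply: tends_ext (tends_cst _) _ => k.
by rewrite lev_orbit //; apply: mval_harmonic.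
Qed.

Lemma embed_isometric h : `|embed_map h| = `|h|.
Proof.
by apply/eqP; rewrite -(@eqrXn2 _ 2%N) // mnormE mdot_embed dotpp.
Qed.

Fact embed_bounded : exists b : R[i], forall h, `|embed_map h| <= b * `|h|.
Proof. by exists 1 => h; rewrite embed_isometric mul1r. Qed.

Definition embed : bounded_op H K := BoundedOp embed_bounded.

Lemma adjoint_embed x : adjoint embed x = x [::].
Proof. by apply: adjoint_unique => h; apply: mdot_embed. Qed.

End Embedding.

End ModelOperators.

(** * The matrix u indexed by pairs, and the commutation relations *)

Lemma sum_pair (V : nmodType) (I J : finType) (F : I * J -> V) :
  \sum_a F a = \sum_i \sum_j F (i, j).
Proof. by rewrite pair_bigA; apply: eq_bigr => -[]. Qed.

Section PairIndex.
Context (R : realType) (m n : nat) (u : 'M[R[i]]_(m * n)).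
Hypothesis hu : u \is unitarymx.

Definition umat (a b : 'I_m * 'I_n) : R[i] :=
  u (mxvec_index a.1 a.2) (mxvec_index b.1 b.2).

Lemma sum_mxvec_index (V : nmodType) (F : 'I_(m * n) -> V) :
  \sum_s F s = \sum_(a : 'I_m * 'I_n) F (mxvec_index a.1 a.2).
Proof.
rewrite (reindex _ (curry_mxvec_bij _ _)) /=.
by apply: eq_bigr => -[].
Qed.

Lemma umat_index_eq (a b : 'I_m * 'I_n) :
  (mxvec_index a.1 a.2 == mxvec_index b.1 b.2) = (a == b).
Proof.
apply/eqP/eqP => [|-> //]; have [g gK _] := curry_mxvec_bij m n.
move: a b => [i j] [k l] /= /(congr1 g).
by have := gK (i, j) isT; have := gK (k, l) isT; rewrite /= => -> ->.
Qed.

Lemma umat_rows a c : \sum_b umat a b * (umat c b)^* = (a == c)%:R.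
Proof.
have /matrixP/(_ (mxvec_index a.1 a.2) (mxvec_index c.1 c.2)) := unitarymxP hu.
rewrite !mxE sum_mxvec_index umat_index_eq => <-.
by apply: eq_bigr => b _; rewrite !mxE.
Qed.

Lemma umat_cols a c : \sum_b (umat b a)^* * umat b c = (a == c)%:R.
Proof.
have hut : u^T \is unitarymx by rewrite trmx_unitary.
have /matrixP/(_ (mxvec_index c.1 c.2) (mxvec_index a.1 a.2)) := unitarymxP hut.
rewrite !mxE sum_mxvec_index umat_index_eq eq_sym => <-.
by apply: eq_bigr => b _; rewrite !mxE mulrC.
Qed.

End PairIndex.

Section RowOperators.
Context (R : realType) (H : hilbertType R).

Lemma l2norm_sqr k (x : 'I_k -> H) : l2norm x ^+ 2 = \sum_i `|x i| ^+ 2.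
Proof. exact: sqrtCK. Qed.

Lemma l2norm_ge0 k (x : 'I_k -> H) : 0 <= l2norm x.
Proof. by rewrite sqrtC_ge0 sumr_ge0 // => i _; rewrite exprn_ge0. Qed.

Lemma row_contraction_sqr k (A : 'I_k -> bounded_op H H) :
  (forall x, `|row_op A x| <= l2norm x) ->
  forall x, `|\sum_i A i (x i)| ^+ 2 <= \sum_i `|x i| ^+ 2.
Proof.
move=> Ax x; rewrite -l2norm_sqr ler_sqr ?nnegrE ?l2norm_ge0 //; exact: Ax.
Qed.

Lemma row_isometry_sqr k (A : 'I_k -> bounded_op H H) :
  (forall x, `|row_op A x| = l2norm x) <->
  forall x, `|\sum_i A i (x i)| ^+ 2 = \sum_i `|x i| ^+ 2.
Proof.
split=> Ax x; first by rewrite -l2norm_sqr -Ax.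
apply/eqP; rewrite -(@eqrXn2 _ 2%N) ?l2norm_ge0 // l2norm_sqr; apply/eqP.
exact: Ax.
Qed.

End RowOperators.

Section Commutation.
Context (R : realType) (m n : nat) (u : 'M[R[i]]_(m * n)) (H : hilbertType R).
Context (s : representation u H).

Lemma rep_comm_pair i j x : rep_e s i (rep_f s j x) =
  \sum_b umat u (i, j) b *: rep_f s b.2 (rep_e s b.1 x).
Proof. by rewrite rep_comm pair_bigA. Qed.

(** Unitarity of u inverts the commutation relations. *)
Lemma rep_comm_inv (hu : u \is unitarymx) i j x : rep_f s j (rep_e s i x) =
  \sum_b (umat u b (i, j))^* *: rep_e s b.1 (rep_f s b.2 x).
Proof.
under [RHS]eq_bigr => b _.
  rewrite rep_comm_pair scaler_sumr -surjective_pairing.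
  under eq_bigr => d _ do rewrite scalerA.
  over.
rewrite exchange_big /= (bigD1 (i, j)) //= -scaler_suml.
rewrite (umat_cols hu) eqxx scale1r big1 ?addr0 // => d dij.
by rewrite -scaler_suml (umat_cols hu) eq_sym (negPf dij) scale0r.
Qed.

(** The row of the products A_i B_j is the composition of the row A with a direct
    sum of copies of the row B. *)
Lemma rep_pair_le : row_contractive s -> forall z : 'I_m * 'I_n -> H,
  `|\sum_a comp_op (rep_e s a.1) (rep_f s a.2) (z a)| ^+ 2 <=
  \sum_a `|z a| ^+ 2.
Proof.
move=> [Ac Bc] z.
rewrite !sum_pair /=; under eq_bigr do rewrite -linear_sum.
apply: le_trans (row_contraction_sqr Ac _) _; apply: ler_sum => i _.
exact: row_contraction_sqr.
Qed.

End Commutation.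

Definition pair_contraction (R : realType) (m n : nat) (u : 'M[R[i]]_(m * n))
    (H : hilbertType R) (s : representation u H) (hs : row_contractive s) :
    row_contraction H ('I_m * 'I_n)%type :=
  RowContraction (rep_pair_le hs).

(** * Lifting the generators to functions on words *)

Section WordOperators.
Context (R : realType) (m n : nat) (u : 'M[R[i]]_(m * n)) (H : hilbertType R).
Context (s : representation u H).
Local Notation letter := ('I_m * 'I_n)%type.
Implicit Types (x : seq letter -> H) (w : seq letter) (a b : letter).

(** If rows S and T of isometries satisfy the commutation relations and add up
    to the identity, then W_(p,q)^* S_i = 0 unless p = i, and
    W_(i,q)^* S_i = T_q^* = sum_(a,k) u_(a,(k,q)) S_k W_a^*.  Reading this at a
    word determines S_i on coordinates; at the empty word S_i is compressed to
    the given generator. *)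
Fixpoint lift_e (i : 'I_m) x w : H :=
  match w with
  | [::] => rep_e s i (x [::])
  | b :: w' =>
      if i == b.1 then
        \sum_a \sum_k umat u a (k, b.2) *: lift_e k (shift a x) w'
      else 0
  end.

(** The analogous identity for T_j is
    W_b^* T_j = sum_(k,l) conj(u_(b,(k,j))) T_l W_(k,l)^*. *)
Fixpoint lift_f (j : 'I_n) x w : H :=
  match w with
  | [::] => rep_f s j (x [::])
  | b :: w' =>
      \sum_a (umat u b (a.1, j))^* *: lift_f a.2 (shift a x) w'
  end.

(** The isometry W_a on coordinates. *)
Definition place a x w : H :=
  match w with
  | [::] => rep_e s a.1 (rep_f s a.2 (x [::]))
  | b :: w' => if a == b then x w' else 0
  end.

Fact lift_e_linear i : linear (lift_e i : (seq letter -> H) -> _).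
Proof.
move=> d x y; apply/funext => w; elim: w i x y => [|b w IH] i x y /=.
  exact: linearP.
rewrite -[RHS]/(d *: lift_e i x (b :: w) + lift_e i y (b :: w)) /=.
case: ifP => _; last by rewrite scaler0 addr0.
rewrite scaler_sumr -big_split; apply: eq_bigr => a _ /=.
rewrite scaler_sumr -big_split; apply: eq_bigr => k _ /=.
by rewrite scalerA mulrC -scalerA -scalerDr; congr (_ *: _); apply: IH.
Qed.
HB.instance Definition _ i := GRing.isLinear.Build R[i] _ _ _ (lift_e i)
  (lift_e_linear i).

Fact lift_f_linear j : linear (lift_f j : (seq letter -> H) -> _).
Proof.
move=> d x y; apply/funext => w; elim: w j x y => [|b w IH] j x y /=.
  exact: linearP.
rewrite -[RHS]/(d *: lift_f j x (b :: w) + lift_f j y (b :: w)) /=.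
rewrite scaler_sumr -big_split; apply: eq_bigr => a _ /=.
by rewrite scalerA mulrC -scalerA -scalerDr; congr (_ *: _); apply: IH.
Qed.
HB.instance Definition _ j := GRing.isLinear.Build R[i] _ _ _ (lift_f j)
  (lift_f_linear j).

Lemma lift_e_sum (B : finType) i (v : B -> R[i]) (z : B -> seq letter -> H) w :
  lift_e i (fun w => \sum_b v b *: z b w) w = \sum_b v b *: lift_e i (z b) w.
Proof.
have -> : (fun w => \sum_b v b *: z b w) = \sum_b v b *: z b.
  by apply/funext => w'; rewrite fct_sumE.
by rewrite linear_sum fct_sumE; apply: eq_bigr => b _; rewrite linearZ.
Qed.

Lemma lift_f_sum (B : finType) j (v : B -> R[i]) (z : B -> seq letter -> H) w :
  lift_f j (fun w => \sum_b v b *: z b w) w = \sum_b v b *: lift_f j (z b) w.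
Proof.
have -> : (fun w => \sum_b v b *: z b w) = \sum_b v b *: z b.
  by apply/funext => w'; rewrite fct_sumE.
by rewrite linear_sum fct_sumE; apply: eq_bigr => b _; rewrite linearZ.
Qed.

Context (hu : u \is unitarymx) (hs : row_contractive s).
Local Notation c := (pair_contraction hs).

Lemma lift_e_harmonic i x : harmonic c x -> harmonic c (lift_e i x).
Proof.
move=> hx w; elim: w i x hx => [|b w IH] i x hx.
  rewrite [RHS]sum_pair (bigD1 i) //= [X in _ = _ + X]big1 ?addr0; last first.
    move=> p pi; rewrite big1 // => q _.
    by rewrite eq_sym (negPf pi) !linear0.
  rewrite -linear_sum; congr (rep_e s i _); rewrite hx eqxx.
  under [RHS]eq_bigr do rewrite linear_sum.
  rewrite [RHS]exchange_big; apply: eq_bigr => d _ /=.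
  rewrite rep_comm_pair sum_pair exchange_big; apply: eq_bigr => q _ /=.
  rewrite linear_sum; apply: eq_bigr => k _.
  by rewrite linearZ -surjective_pairing.
rewrite /=; case: ifP => _; last by rewrite big1 // => a _; rewrite !linear0.
under eq_bigr => a _.
  under eq_bigr => k _ do
    rewrite (IH k _ (harmonic_shift a hx)) scaler_sumr.
  rewrite exchange_big.
  over.
rewrite exchange_big; apply: eq_bigr => d _ /=.
rewrite !linear_sum; apply: eq_bigr => a _.
by rewrite !linear_sum; apply: eq_bigr => k _; rewrite !linearZ.
Qed.

Lemma lift_f_harmonic j x : harmonic c x -> harmonic c (lift_f j x).
Proof.
move=> hx w; elim: w j x hx => [|b w IH] j x hx /=.
  under [RHS]eq_bigr do rewrite !linear_sum.
  rewrite [RHS]exchange_big hx linear_sum; apply: eq_bigr => d _ /=.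
  rewrite (rep_comm_inv _ hu) -?surjective_pairing; apply: eq_bigr => a _.
  by rewrite !linearZ.
under eq_bigr => a _ do rewrite (IH _ _ (harmonic_shift a hx)) scaler_sumr.
rewrite exchange_big; apply: eq_bigr => d _ /=.
by rewrite !linear_sum; apply: eq_bigr => a _; rewrite !linearZ.
Qed.

Lemma place_sum x w : harmonic c x -> \sum_a place a (shift a x) w = x w.
Proof.
move=> hx; case: w => [|b w] /=; first by rewrite hx.
by rewrite (bigD1 b) //= eqxx big1 ?addr0 // => a /negPf ->.
Qed.

(** The composite isometries are the W_a: the recursions of [lift_e] and [lift_f]
    apply u and its conjugate one after the other. *)
Lemma lift_ef i j x w : harmonic c x -> lift_e i (lift_f j x) w = place (i, j) x w.
Proof.
elim: w i j x => [|b w IH] i j x hx //=.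
case: (altP (i =P b.1)) => [ib|ib]; last first.
  by rewrite (_ : _ == b = false) //; apply: contraNF ib => /eqP <-.
pose G k d := lift_e k (lift_f d.2 (shift d x)) w.
(* By unitarity of u only the terms with d.1 = k survive, and only if j is the
   second half of the letter b. *)
transitivity (\sum_k \sum_d ((d.1, j) == (k, b.2))%:R *: G k d).
  have E a k : umat u a (k, b.2) *: lift_e k (shift a (lift_f j x)) w =
      \sum_d ((umat u a (d.1, j))^* * umat u a (k, b.2)) *: G k d.
    rewrite (_ : shift a (lift_f j x) = fun w => \sum_d (umat u a (d.1, j))^*
      *: lift_f d.2 (shift d x) w) // lift_e_sum scaler_sumr.
    by apply: eq_bigr => d _; rewrite scalerA mulrC.
  under eq_bigr do under eq_bigr do rewrite E.
  rewrite exchange_big; apply: eq_bigr => k _ /=.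
  rewrite exchange_big; apply: eq_bigr => d _ /=.
  by rewrite -scaler_suml (umat_cols hu).
rewrite exchange_big /=.
under eq_bigr => d _.
  rewrite (bigD1 d.1) //= big1 ?addr0; last first.
    by move=> k kd; rewrite xpair_eqE eq_sym (negPf kd) scale0r.
  rewrite xpair_eqE eqxx /G IH -?surjective_pairing; last exact: harmonic_shift.
  over.
have -> : ((i, j) == b) = (j == b.2).
  by rewrite [b in LHS]surjective_pairing xpair_eqE ib eqxx.
rewrite -scaler_sumr place_sum //=.
by case: (j == b.2); rewrite ?scale1r ?scale0r.
Qed.

Lemma lift_fe i j x w : harmonic c x ->
  lift_f j (lift_e i x) w = \sum_a (umat u a (i, j))^* *: place a x w.
Proof.
elim: w i j x => [|b w IH] i j x hx /=.
  by rewrite (rep_comm_inv _ hu).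
transitivity ((umat u b (i, j))^* *: x w); last first.
  rewrite (bigD1 b) //= eqxx big1 ?addr0 // => a /negPf ->.
  by rewrite scaler0.
rewrite sum_pair (bigD1 i) //= [X in _ + X]big1 ?addr0; last first.
  move=> k ki; rewrite big1 // => l _.
  rewrite (_ : shift (k, l) (lift_e i x) = 0) ?linear0 ?scaler0 //.
  by apply/funext => v; rewrite /shift /= eq_sym (negPf ki).
rewrite -scaler_sumr; congr (_ *: _).
rewrite -(place_sum _ hx).
pose G d a := place a (shift d x) w.
have E l : lift_f l (shift (i, l) (lift_e i x)) w =
    \sum_d \sum_k \sum_a (umat u d (k, l) * (umat u a (k, l))^*) *: G d a.
  rewrite (_ : shift (i, l) (lift_e i x) = fun w => \sum_(e : letter * 'I_m)
    umat u e.1 (e.2, l) *: lift_e e.2 (shift e.1 x) w); last first.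
    by apply/funext => v; rewrite /shift /= eqxx [RHS]sum_pair.
  rewrite lift_f_sum sum_pair; apply: eq_bigr => d _; apply: eq_bigr => k _ /=.
  rewrite IH; last exact: harmonic_shift.
  by rewrite scaler_sumr; apply: eq_bigr => a _; rewrite scalerA.
rewrite (eq_bigr _ (fun l _ => E l)) exchange_big; apply: eq_bigr => d _ /=.
transitivity (\sum_a (d == a)%:R *: G d a); last first.
  rewrite (bigD1 d) //= eqxx scale1r big1 ?addr0 // => a ad.
  by rewrite eq_sym (negPf ad) scale0r.
rewrite exchange_big /=; under eq_bigr do rewrite exchange_big.
rewrite exchange_big; apply: eq_bigr => a _ /=.
by rewrite -(umat_rows hu) scaler_suml sum_pair.
Qed.

End WordOperators.

Section WordContractions.
Context (R : realType) (m n : nat) (u : 'M[R[i]]_(m * n)) (H : hilbertType R).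
Context (s : representation u H) (hu : u \is unitarymx).
Context (hs : row_contractive s).
Local Notation letter := ('I_m * 'I_n)%type.

(** One level up, the row of lifts acts through the same row of lifts on the
    functions y b l, which arise from the x i by a unitary change of letters. *)
Lemma lev_lift_e k (x : 'I_m -> seq letter -> H) :
  lev k (fun w => \sum_i lift_e s i (x i) w)
        (fun w => \sum_i lift_e s i (x i) w) <= \sum_i lev k (x i) (x i).
Proof.
elim: k x => [|k IH] x /=.
  rewrite dotpp; apply: le_trans (row_contraction_sqr hs.1 _) _.
  by apply: ler_sum => i _; rewrite dotpp.
pose y b l w := \sum_a umat u a (l, b.2) *: shift a (x b.1) w.
have yE b : shift b (fun w => \sum_i lift_e s i (x i) w) =
    fun w => \sum_l lift_e s l (y b l) w.
  apply/funext => w; rewrite /shift /= (bigD1 b.1) //= eqxx.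
  rewrite [X in _ + X]big1 ?addr0; last by move=> i /negPf ->.
  rewrite exchange_big; apply: eq_bigr => l _ /=.
  by rewrite lift_e_sum.
under eq_bigr do rewrite yE.
apply: le_trans (ler_sum _ (fun b _ => IH (y b))) _.
rewrite sum_pair le_eqVlt; apply/orP; left; apply/eqP; apply: eq_bigr => p _.
rewrite exchange_big -(sum_pair (fun d => lev k (y (p, d.2) d.1) (y (p, d.2) d.1))).
rewrite -[RHS](@lev_unitary _ _ _ _ _ (fun d a => umat u a d)); last first.
  by move=> a b; rewrite umat_rows.
by apply: eq_bigr => -[].
Qed.

Lemma lev_lift_f k (x : 'I_n -> seq letter -> H) :
  lev k (fun w => \sum_j lift_f s j (x j) w)
        (fun w => \sum_j lift_f s j (x j) w) <= \sum_j lev k (x j) (x j).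
Proof.
elim: k x => [|k IH] x /=.
  rewrite dotpp; apply: le_trans (row_contraction_sqr hs.2 _) _.
  by apply: ler_sum => i _; rewrite dotpp.
pose y b l w := \sum_d (umat u b d)^* *: shift (d.1, l) (x d.2) w.
have yE b : shift b (fun w => \sum_j lift_f s j (x j) w) =
    fun w => \sum_l lift_f s l (y b l) w.
  apply/funext => w; rewrite /shift /=.
  under eq_bigr do rewrite sum_pair exchange_big.
  rewrite exchange_big; apply: eq_bigr => l _ /=.
  by rewrite lift_f_sum sum_pair exchange_big.
under eq_bigr do rewrite yE.
apply: le_trans (ler_sum _ (fun b _ => IH (y b))) _.
rewrite exchange_big /=.
under eq_bigr => l _.
  rewrite (@lev_unitary _ _ _ _ _ (fun b d => (umat u b d)^*)); last first.
    move=> a b; rewrite -(umat_cols hu); apply: eq_bigr => d _.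
    by rewrite conjCK.
  rewrite sum_pair exchange_big /=.
  over.
rewrite exchange_big /=.
under [leRHS]eq_bigr do rewrite sum_pair exchange_big.
by [].
Qed.

End WordContractions.

(** * The dilation on harmonic functions *)

Section RowUnitary.
Context (R : realType) (H : hilbertType R) (k : nat).

Lemma row_isometry_dotp (V : 'I_k -> bounded_op H H) :
  (forall x, `|\sum_i V i (x i)| ^+ 2 = \sum_i `|x i| ^+ 2) ->
  forall i j x y, dotp (V i x) (V j y) = (i == j)%:R * dotp x y.
Proof.
move=> Viso i j x y.
have E a : `|V i x + a *: V j y| ^+ 2 = if i == j then `|x + a *: y| ^+ 2
    else `|x| ^+ 2 + `|a| ^+ 2 * `|y| ^+ 2.
  have := Viso (fun l => (if l == i then x else 0) + (if l == j then a *: y else 0)).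
  have V1 l z : \sum_p V p (if p == l then z else 0) = V l z.
    rewrite (bigD1 l) //= eqxx big1 ?addr0 // => p /negPf ->.
    exact: linear0.
  under eq_bigr do rewrite linearD.
  rewrite big_split /= !V1 linearZ (bigD1 i) //= eqxx => ->.
  case: (altP (i =P j)) => [<-|ij].
    rewrite big1 ?addr0 // => p /negPf ->.
    by rewrite addr0 normr0 expr0n.
  have ji : (j == i) = false by rewrite eq_sym (negPf ij).
  rewrite addr0 (bigD1 j) ?ji //= eqxx add0r normrZ.
  rewrite exprMn big1 ?addr0 // => p /andP[/negPf -> /negPf ->].
  by rewrite addr0 normr0 expr0n.
apply: (mulfI (x := 4%:R)); first by rewrite pnatr_eq0.
rewrite dotp_polarization.
have -> : V i x + V j y = V i x + 1 *: V j y by rewrite scale1r.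
have -> : V i x - V j y = V i x + (-1) *: V j y by rewrite scaleN1r.
have -> : V i x - 'i *: V j y = V i x + (- 'i) *: V j y by rewrite scaleNr.
rewrite !E; case: eqP => _.
  by rewrite mulr1n mul1r scale1r scaleN1r scaleNr -dotp_polarization.
rewrite !normrN normr1 normCi !expr1n mulr0n; ring.
Qed.

Lemma row_unitary_defect_free (V : 'I_k -> bounded_op H H) :
  (forall x, `|\sum_i V i (x i)| ^+ 2 = \sum_i `|x i| ^+ 2) ->
  (forall x, exists y, x = \sum_i V i (y i)) ->
  forall x, \sum_i V i (adjoint (V i) x) = x.
Proof.
move=> Viso Vonto x; have [y ->] := Vonto x; apply: eq_bigr => i _.
congr (V i _); apply: adjoint_unique => z.
rewrite dotp_sumr (bigD1 i) //= row_isometry_dotp // eqxx mul1r big1 ?addr0 //.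
by move=> j ji; rewrite row_isometry_dotp // eq_sym (negPf ji) mul0r.
Qed.

End RowUnitary.

Section Dilation.
Context (R : realType) (m n : nat) (u : 'M[R[i]]_(m * n)) (H : hilbertType R).
Context (s : representation u H) (hu : u \is unitarymx).
Context (hs : row_contractive s).
Local Notation letter := ('I_m * 'I_n)%type.
Local Notation c := (pair_contraction hs).
Local Notation K := (modelH c).

Lemma lev_lift_e1 i k x : lev k (lift_e s i x) (lift_e s i x) <= lev k x x.
Proof. exact: (lev_row_entry (lev_lift_e hu hs)). Qed.

Lemma lev_lift_f1 j k x : lev k (lift_f s j x) (lift_f s j x) <= lev k x x.
Proof. exact: (lev_row_entry (lev_lift_f hu hs)). Qed.

Definition model_e i : bounded_op K K :=
  model_op (@lift_e_harmonic _ _ _ _ _ _ hs i) (lev_lift_e1 i).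

Definition model_f j : bounded_op K K :=
  model_op (@lift_f_harmonic _ _ _ _ _ _ hu hs j) (lev_lift_f1 j).

Lemma model_efE i j (x : K) w :
  (model_e i (model_f j x) : model c) w = place s (i, j) x w.
Proof. by rewrite /= (lift_ef hu _ _ _ (mval_harmonic x)). Qed.

Lemma mshift_ef i j (x : K) b : mshift b (model_e i (model_f j x)) =
  if (i, j) == b then x else 0.
Proof.
apply/mval_inj => w; transitivity (place s (i, j) x (b :: w)).
  exact: model_efE.
by rewrite /=; case: ifP.
Qed.

Lemma model_feE i j (x : K) : model_f j (model_e i x) =
  \sum_a (umat u a (i, j))^* *: model_e a.1 (model_f a.2 x).
Proof.
apply/mval_inj => w; rewrite mval_sum /= (lift_fe hu _ _ _ (mval_harmonic x)).
apply: eq_bigr => a _; congr (_ *: _).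
by rewrite (lift_ef hu _ _ _ (mval_harmonic x)) -surjective_pairing.
Qed.

Lemma model_ef_comm i j (x : K) : model_e i (model_f j x) =
  \sum_b umat u (i, j) b *: model_f b.2 (model_e b.1 x).
Proof.
under [RHS]eq_bigr => b _.
  rewrite model_feE scaler_sumr -surjective_pairing.
  under eq_bigr => a _ do rewrite scalerA.
  over.
rewrite exchange_big /= (bigD1 (i, j)) //= -scaler_suml umat_rows // eqxx.
rewrite scale1r big1 ?addr0 // => a ij.
by rewrite -scaler_suml umat_rows // eq_sym (negPf ij) scale0r.
Qed.

Definition model_rep : representation u K.
Proof.
refine (@Representation _ _ _ _ _ model_e model_f _) => i j x.
by rewrite model_ef_comm sum_pair.
Defined.

Lemma model_e_le (y : 'I_m -> K) :
  `|\sum_i model_e i (y i)| ^+ 2 <= \sum_i `|y i| ^+ 2.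
Proof.
rewrite [leLHS]mnormE; apply: mdot_le => [|k].
  by apply: sumr_ge0 => i _; rewrite exprn_ge0.
have -> : mval (\sum_i model_e i (y i)) = fun w => \sum_i lift_e s i (y i) w.
  by apply/funext => w; rewrite mval_sum.
apply: le_trans (lev_lift_e hu hs k _) _; apply: ler_sum => i _.
by rewrite [leRHS]mnormE lev_le_mdot.
Qed.

Lemma model_f_le (y : 'I_n -> K) :
  `|\sum_j model_f j (y j)| ^+ 2 <= \sum_j `|y j| ^+ 2.
Proof.
rewrite [leLHS]mnormE; apply: mdot_le => [|k].
  by apply: sumr_ge0 => i _; rewrite exprn_ge0.
have -> : mval (\sum_j model_f j (y j)) = fun w => \sum_j lift_f s j (y j) w.
  by apply/funext => w; rewrite mval_sum.
apply: le_trans (lev_lift_f hu hs k _) _; apply: ler_sum => i _.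
by rewrite [leRHS]mnormE lev_le_mdot.
Qed.

Lemma model_ef_isometry (y : letter -> K) :
  `|\sum_a model_e a.1 (model_f a.2 (y a))| ^+ 2 = \sum_a `|y a| ^+ 2.
Proof.
rewrite [LHS]mnormE mdot_shift; apply: eq_bigr => b _; rewrite [RHS]mnormE.
suff -> : mshift b (\sum_a model_e a.1 (model_f a.2 (y a))) = y b by [].
apply/mval_inj => w; transitivity (\sum_a place s a (y a) (b :: w)).
  rewrite -[LHS]/((_ : model c) (b :: w)) mval_sum; apply: eq_bigr => a _.
  by rewrite model_efE -surjective_pairing.
rewrite (bigD1 b) //= eqxx big1 ?addr0 // => a /negPf ab.
by rewrite ab.
Qed.

(** Composing the row S with the contraction T_j gives a family that preserves
    sums of squared norms, so S itself cannot decrease them. *)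
Lemma model_e_isometry (hn : (0 < n)%N) (y : 'I_m -> K) :
  `|\sum_i model_e i (y i)| ^+ 2 = \sum_i `|y i| ^+ 2.
Proof.
apply/eqP; rewrite eq_le model_e_le /=; have j := Ordinal hn.
have <- : `|model_f j (\sum_i model_e i (y i))| ^+ 2 = \sum_i `|y i| ^+ 2.
  rewrite linear_sum; under eq_bigr do rewrite model_feE.
  rewrite exchange_big /=.
  under eq_bigr => a _.
    under eq_bigr => i _ do rewrite -!linearZ.
    rewrite -!linear_sum.
    over.
  rewrite (model_ef_isometry (fun a => \sum_i (umat u a (i, j))^* *: y i)).
  apply: norm_unitary => i i'; rewrite (eq_bigr (fun a =>
    (umat u a (i, j))^* * umat u a (i', j))) => [|a _]; last by rewrite conjCK.
  by rewrite umat_cols // xpair_eqE eqxx andbT.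
by rewrite ler_sqr ?nnegrE //; apply: model_map_le.
Qed.

Lemma model_f_isometry (hm : (0 < m)%N) (y : 'I_n -> K) :
  `|\sum_j model_f j (y j)| ^+ 2 = \sum_j `|y j| ^+ 2.
Proof.
apply/eqP; rewrite eq_le model_f_le /=; have i := Ordinal hm.
have <- : `|model_e i (\sum_j model_f j (y j))| ^+ 2 = \sum_j `|y j| ^+ 2.
  have := model_ef_isometry (fun a => if a.1 == i then y a.2 else 0).
  rewrite !sum_pair (bigD1 i) //= eqxx [X in _ + X]big1 ?addr0; last first.
    by move=> k /negPf ->; rewrite big1 // => l _; rewrite !linear0.
  rewrite -linear_sum [in RHS](bigD1 i) //= eqxx [X in _ + X]big1 ?addr0 //.
  by move=> k /negPf ->; rewrite big1 // => l _; rewrite normr0 expr0n.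
by rewrite ler_sqr ?nnegrE //; apply: model_map_le.
Qed.

Lemma model_ef_onto (x : K) :
  \sum_a model_e a.1 (model_f a.2 (mshift a x)) = x.
Proof.
apply/mval_inj => w; rewrite mval_sum -[RHS](place_sum w (mval_harmonic x)).
by apply: eq_bigr => a _; rewrite model_efE -surjective_pairing.
Qed.

Lemma model_e_onto (x : K) : exists y, x = \sum_i model_e i (y i).
Proof.
exists (fun i => \sum_j model_f j (mshift (i, j) x)).
rewrite -[LHS]model_ef_onto sum_pair; apply: eq_bigr => i _.
by rewrite linear_sum.
Qed.

(** The same expansion as in [model_e_onto], with W_a rewritten in the order
    T S. *)
Lemma model_f_onto (x : K) : exists y, x = \sum_j model_f j (y j).
Proof.
exists (fun j => \sum_i model_e i (\sum_a umat u a (i, j) *: mshift a x)).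
rewrite -[LHS]model_ef_onto.
under eq_bigr do rewrite model_ef_comm -surjective_pairing.
rewrite exchange_big sum_pair exchange_big; apply: eq_bigr => j _ /=.
rewrite linear_sum; apply: eq_bigr => i _.
by rewrite !linear_sum; apply: eq_bigr => a _; rewrite !linearZ.
Qed.

Lemma model_star (hm : (0 < m)%N) (hn : (0 < n)%N) :
  star_representation model_rep.
Proof.
have eiso := model_e_isometry hn; have fiso := model_f_isometry hm.
split; split; try exact/row_isometry_sqr.
  exact: (row_unitary_defect_free eiso model_e_onto).
exact: (row_unitary_defect_free fiso model_f_onto).
Qed.

End Dilation.

Section RepWords.
Context (R : realType) (m n : nat) (u : 'M[R[i]]_(m * n)).
Context (K : hilbertType R) (p : representation u K).

Lemma invariant_under_gens (M : set K) :
  (forall i x, M x -> M (rep_e p i x)) -> (forall j x, M x -> M (rep_f p j x)) ->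
  invariant_under p M.
Proof. by move=> Me Mf; elim=> [//|[i|j] w IH] x Mx /=; [apply/Me/IH|apply/Mf/IH]. Qed.

Lemma rep_word_intertwine (H : hilbertType R) (s : representation u H)
    (f : K -> H) :
  (forall i x, f (rep_e p i x) = rep_e s i (f x)) ->
  (forall j x, f (rep_f p j x) = rep_f s j (f x)) ->
  forall w x, f (rep_word p w x) = rep_word s w (f x).
Proof. by move=> fe ff; elim=> [//|[i|j] w IH] x /=; rewrite ?fe ?ff IH. Qed.

End RepWords.

Section MinimalDilation.
Context (R : realType) (m n : nat) (u : 'M[R[i]]_(m * n)) (H : hilbertType R).
Context (s : representation u H) (hu : u \is unitarymx).
Context (hs : row_contractive s) (hdf : defect_free s).
Local Notation c := (pair_contraction hs).
Local Notation K := (modelH c).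
Local Notation p := (model_rep hu hs).

Lemma pair_defect_free h : \sum_a c a (adjoint (c a) h) = h.
Proof.
under eq_bigr do rewrite adjoint_comp.
rewrite sum_pair -[RHS](hdf.1 h); apply: eq_bigr => i _ /=.
by rewrite -linear_sum; congr (rep_e s i _); apply: hdf.2.
Qed.

Local Notation J := (embed pair_defect_free).

Definition root (x : K) : H := (x : model c) [::].

Fact root_linear : linear root.
Proof. by []. Qed.
HB.instance Definition _ := GRing.isLinear.Build R[i] K H _ root root_linear.

Lemma root_word w x : root (rep_word p w x) = rep_word s w (root x).
Proof. exact: (rep_word_intertwine (f := root)). Qed.

(** The functions vanishing at the empty word form the orthogonal complement of
    the range of J, and they are invariant because evaluation at the empty word
    intertwines. *)
Lemma model_semi_invariant : semi_invariant p (range J).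
Proof.
exists [set x | root x = 0]; split.
- split=> [||a x y /= x0 y0]; first 2 last.
  + by transitivity (a *: root x + root y); rewrite // x0 y0 scaler0 addr0.
  + apply: (@closed_linear_ker _ _ _ root 1) => x.
    by rewrite mul1r; apply: coord_le_norm.
  + by [].
- move=> y y0 _ [h _ <-]; have := mdot_embed pair_defect_free h y.
  by rewrite [y [::]]y0 dotp0r.
- move=> w x /= x0; rewrite root_word x0; elim: w => //= g w ->.
  by case: g => ?; rewrite linear0.
- move=> w x _; exists (rep_word p w x - J (root (rep_word p w x))).
    exact: (subrr (root (rep_word p w x))).
  exists (J (root (rep_word p w x))); first by exists (root (rep_word p w x)).
  by rewrite subrK.
Qed.

Lemma model_dilation : dilation s p J.
Proof.
split; [exact: embed_isometric|exact: model_semi_invariant|move=> w x].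
by rewrite adjoint_embed -/(root _) root_word.
Qed.

Lemma dotp_model_ef i j (x y : K) :
  dotp (model_e hu hs i (model_f hu hs j x)) y = dotp x (mshift (i, j) y : K).
Proof.
rewrite [LHS]mdot_shift (bigD1 (i, j)) // mshift_ef eqxx.
rewrite big1; first exact: addr0.
by move=> b bij; rewrite mshift_ef eq_sym (negPf bij); apply: dot0l.
Qed.

(** Let y be orthogonal to a reducing M that contains JH.  Then y vanishes at the
    empty word, and every shift of y is orthogonal to M because M is invariant
    under the W_a; so y vanishes everywhere. *)
Lemma model_minimal : minimal_dilation s p J.
Proof.
split; first exact: model_dilation.
apply/seteqP; split=> // z _ M [[Mcl Minv _] JM].
suff -> : M = setT by [].
apply: ortho_compl0_setT => // y My; apply/mval_inj => w.
elim: w y My => [|a w IH] y My.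
  apply: eq_of_dotp => h; rewrite -(mdot_embed pair_defect_free).
  by rewrite dotp0r; apply: My; apply: JM; exists h.
apply: (IH (mshift a y)) => x Mx.
rewrite -/(dotp x (mshift a y : K)) [a]surjective_pairing -dotp_model_ef.
exact: My (Minv [:: inl a.1; inr a.2] x Mx).
Qed.

End MinimalDilation.

(** * Coordinates of an arbitrary dilation *)

Section Contractions.
Context (R : realType).

(** The compression of V_i^* to JH is A_i^*, and both rows are coisometric, so
    that sum_i |V_i^* J h|^2 = |h|^2 = sum_i |A_i^* h|^2: nothing of V_i^* J h
    lies outside JH. *)
Lemma dilated_coisometry (H K : hilbertType R) k (A : 'I_k -> bounded_op H H)
    (V : 'I_k -> bounded_op K K) (J : bounded_op H K) :
  isometric J -> (forall i h, adjoint J (V i (J h)) = A i h) ->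
  (forall h, \sum_i A i (adjoint (A i) h) = h) ->
  (forall x, \sum_i V i (adjoint (V i) x) = x) ->
  forall i h, adjoint (V i) (J h) = J (adjoint (A i) h).
Proof.
move=> Jiso AV AA VV i h; apply/eqP; rewrite -subr_eq0 -dotpp_eq0.
pose D i := adjoint (V i) (J h) - J (adjoint (A i) h).
have D0 j : 0 <= dotp (D j) (D j) by apply: dotpp_ge0.
suff DD : \sum_j dotp (D j) (D j) = 0.
  have /psumr_eq0P/(_ DD i) : forall j, true -> 0 <= dotp (D j) (D j) by [].
  by move=> ->.
have VJ j : dotp (adjoint (V j) (J h)) (J (adjoint (A j) h)) =
    dotp h (A j (adjoint (A j) h)).
  by rewrite -dotp_adjointr dotp_adjoint AV.
have JV j : dotp (J (adjoint (A j) h)) (adjoint (V j) (J h)) =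
    dotp (A j (adjoint (A j) h)) h.
  by rewrite dotpC VJ -dotpC.
have E j : dotp (D j) (D j) = dotp (V j (adjoint (V j) (J h))) (J h)
    - dotp h (A j (adjoint (A j) h)) - dotp (A j (adjoint (A j) h)) h
    + dotp (A j (adjoint (A j) h)) h.
  rewrite /D !dotpBl !dotpBr VJ JV dotp_adjoint !dotpp Jiso -!dotpp.
  by rewrite [dotp (V j _) _]dotp_adjoint; ring.
rewrite (eq_bigr _ (fun j _ => E j)) !big_split /= !sumrN.
rewrite -!dotp_suml -dotp_sumr AA VV !dotpp Jiso; ring.
Qed.

Lemma contraction_fix (K L : hilbertType R) (G : bounded_op K L) y :
  (forall x, `|G x| <= `|x|) -> `|G y| = `|y| -> adjoint G (G y) = y.
Proof.
move=> G1 Gy; apply/eqP; rewrite -subr_eq0 -dotpp_eq0 eq_le dotpp_ge0 andbT.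
have GG : dotp (adjoint G (G y)) y = dotp y y.
  by rewrite -dotp_adjointr !dotpp Gy.
have GG' : dotp y (adjoint G (G y)) = dotp y y by rewrite dotpC GG -dotpC.
rewrite dotpBl !dotpBr GG GG' subrr subr0 subr_le0 !dotpp.
rewrite ler_sqr ?nnegrE // -[leRHS]Gy -[leRHS]mul1r norm_adjoint_le //.
by move=> x; rewrite mul1r.
Qed.

End Contractions.

Section StarRep.
Context (R : realType) (m n : nat) (u : 'M[R[i]]_(m * n)) (K : hilbertType R).
Context (p : representation u K) (hp : star_representation p).

Lemma star_adj_e i k x : adjoint (rep_e p i) (rep_e p k x) = (i == k)%:R *: x.
Proof.
apply: adjoint_unique => z; rewrite (row_isometry_dotp (iffLR (row_isometry_sqr _) hp.1.1)).
by rewrite dotpZr rmorph_nat.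
Qed.

Lemma star_adj_f j l x : adjoint (rep_f p j) (rep_f p l x) = (j == l)%:R *: x.
Proof.
apply: adjoint_unique => z; rewrite (row_isometry_dotp (iffLR (row_isometry_sqr _) hp.1.2)).
by rewrite dotpZr rmorph_nat.
Qed.

(** The operator W_a^*. *)
Definition unplace (a : 'I_m * 'I_n) (x : K) : K :=
  adjoint (rep_f p a.2) (adjoint (rep_e p a.1) x).

Lemma star_expand x : x = \sum_a rep_e p a.1 (rep_f p a.2 (unplace a x)).
Proof.
rewrite sum_pair -[LHS]hp.2.1; apply: eq_bigr => i _ /=.
by rewrite /unplace /= -linear_sum hp.2.2.
Qed.

Lemma unplace_norm x : \sum_a `|unplace a x| ^+ 2 = `|x| ^+ 2.
Proof.
rewrite -dotpp {3}[x]star_expand dotp_sumr; apply: eq_bigr => a _.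
by rewrite !dotp_adjointr dotpp.
Qed.

(** Expand x as a sum of W_a W_a^* x and move T to the front by the commutation
    relations; T_q^* then selects the terms with second index q. *)
Lemma star_adj_f_expand q x : adjoint (rep_f p q) x =
  \sum_a \sum_k umat u a (k, q) *: rep_e p k (unplace a x).
Proof.
rewrite {1}[x]star_expand linear_sum; apply: eq_bigr => a _.
rewrite rep_comm_pair -surjective_pairing linear_sum sum_pair.
apply: eq_bigr => k _; rewrite (bigD1 q) //= adjointZ star_adj_f eqxx scale1r.
by rewrite big1 ?addr0 // => l lq; rewrite adjointZ star_adj_f eq_sym (negPf lq) scale0r scaler0.
Qed.

Lemma unplace_f (hu : u \is unitarymx) b j x : unplace b (rep_f p j x) =
  \sum_a (umat u b (a.1, j))^* *: rep_f p a.2 (unplace a x).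
Proof.
rewrite -{1}[x]hp.2.1 linear_sum /unplace !linear_sum sum_pair.
apply: eq_bigr => k _ /=; rewrite rep_comm_inv // !linear_sum (bigD1 b) //= big1 ?addr0.
  rewrite !adjointZ star_adj_e adjointZ star_adj_f !eqxx !scale1r.
  by rewrite -scaler_sumr hp.2.2.
move=> a ab; rewrite !adjointZ star_adj_e adjointZ star_adj_f.
have : (b.1 == a.1) && (b.2 == a.2) = false.
  by move: a b ab => [a1 a2] [b1 b2]; rewrite xpair_eqE /= eq_sym (eq_sym a2); case: eqP; case: eqP.
by case: (b.1 == a.1) => /= [->|_]; rewrite !scale0r ?scaler0.
Qed.

End StarRep.

Section Coordinates.
Context (R : realType) (m n : nat) (u : 'M[R[i]]_(m * n)) (H K : hilbertType R).
Context (s : representation u H) (hu : u \is unitarymx).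
Context (hs : row_contractive s) (hdf : defect_free s).
Context (p : representation u K) (J : bounded_op H K).
Context (hp : star_representation p) (hJ : dilation s p J).
Local Notation c := (pair_contraction hs).
Local Notation letter := ('I_m * 'I_n)%type.

Let Jiso : isometric J. Proof. by case: hJ. Qed.

Lemma dilation_adjJ h : adjoint J (J h) = h.
Proof. by have [_ _ cmp] := hJ; apply: (cmp [::]). Qed.

Lemma dilation_adj_e i h : adjoint (rep_e p i) (J h) = J (adjoint (rep_e s i) h).
Proof.
apply: (dilated_coisometry Jiso) => [k g||].
- by have [_ _ cmp] := hJ; apply: (cmp [:: inl k]).
- exact: hdf.1.
- exact: hp.2.1.
Qed.

Lemma dilation_adj_f j h : adjoint (rep_f p j) (J h) = J (adjoint (rep_f s j) h).
Proof.
apply: (dilated_coisometry Jiso) => [k g||].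
- by have [_ _ cmp] := hJ; apply: (cmp [:: inr k]).
- exact: hdf.2.
- exact: hp.2.2.
Qed.

Lemma adjJ_e i x : adjoint J (rep_e p i x) = rep_e s i (adjoint J x).
Proof.
apply: adjoint_unique => h; rewrite dotp_adjointr dilation_adj_e.
by rewrite dotp_adjoint dotp_adjointr.
Qed.

Lemma adjJ_f j x : adjoint J (rep_f p j x) = rep_f s j (adjoint J x).
Proof.
apply: adjoint_unique => h; rewrite dotp_adjointr dilation_adj_f.
by rewrite dotp_adjoint dotp_adjointr.
Qed.

(** The coordinates P_H W_w^* x. *)
Fixpoint coords (x : K) (w : seq letter) : H :=
  if w is a :: w' then coords (unplace p a x) w' else adjoint J x.

Lemma coords_linear a x y w : coords (a *: x + y) w = a *: coords x w + coords y w.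
Proof.
elim: w x y => [|b w IH] x y /=; first exact: adjointP.
by rewrite /unplace !adjointP IH.
Qed.

Fact coords_is_linear : linear coords.
Proof. by move=> a x y; apply/funext => w; apply: coords_linear. Qed.
HB.instance Definition _ := GRing.isLinear.Build R[i] K (seq letter -> H) _
  coords coords_is_linear.

Lemma coords_harmonic x : harmonic c (coords x).
Proof.
move=> w; elim: w x => [|b w IH] x /=; last exact: IH.
rewrite {1}[x](star_expand hp) linear_sum; apply: eq_bigr => a _.
by rewrite /= adjJ_e adjJ_f.
Qed.

Lemma lev_coords k x : lev k (coords x) (coords x) <= `|x| ^+ 2.
Proof.
elim: k x => [|k IH] x /=.
  rewrite dotpp ler_sqr ?nnegrE // -[leRHS]mul1r norm_adjoint_le // => h.
  by rewrite mul1r Jiso.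
by rewrite -(unplace_norm hp x); apply: ler_sum => a _; apply: IH.
Qed.

Fact coords_in_model x : coords x \in in_model c.
Proof.
apply/asboolP; split; first exact: coords_harmonic.
by exists (`|x| ^+ 2) => k; apply: lev_coords.
Qed.

Definition to_model_map (x : K) : modelH c := Model (coords_in_model x).

Fact to_model_linear : linear to_model_map.
Proof. by move=> a x y; apply/mval_inj => w; apply: coords_linear. Qed.
HB.instance Definition _ := GRing.isLinear.Build R[i] K (modelH c) _
  to_model_map to_model_linear.

Lemma to_model_le x : `|to_model_map x| <= `|x|.
Proof.
rewrite -ler_sqr ?nnegrE // mnormE; apply: mdot_le => [|k].
  by rewrite exprn_ge0.
exact: lev_coords.
Qed.

Fact to_model_bounded : exists b : R[i], forall x, `|to_model_map x| <= b * `|x|.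
Proof. by exists 1 => x; rewrite mul1r to_model_le. Qed.

Definition to_model : bounded_op K (modelH c) := BoundedOp to_model_bounded.

Lemma to_model_embed h : to_model (J h) = embed (pair_defect_free hs hdf) h.
Proof.
apply/mval_inj => w /=; elim: w h => [|a w IH] h /=; first exact: dilation_adjJ.
by rewrite /unplace dilation_adj_e dilation_adj_f IH adjoint_comp.
Qed.

(** Both sides satisfy the recursion that defines [lift_e]. *)
Lemma to_model_e i x : to_model (rep_e p i x) = rep_e (model_rep hu hs) i (to_model x).
Proof.
apply/mval_inj => w /=; elim: w i x => [|b w IH] i x /=; first exact: adjJ_e.
rewrite {1}/unplace star_adj_e // eq_sym; case: eqP => _; last first.
  by rewrite scale0r linear0 -[coords _]/(coords 0) linear0.
rewrite scale1r star_adj_f_expand // !linear_sum fct_sumE; apply: eq_bigr => a _.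
rewrite linear_sum fct_sumE; apply: eq_bigr => k _.
by rewrite linearZ /= -IH.
Qed.

Lemma to_model_f j x : to_model (rep_f p j x) = rep_f (model_rep hu hs) j (to_model x).
Proof.
apply/mval_inj => w /=; elim: w j x => [|b w IH] j x /=; first exact: adjJ_f.
rewrite unplace_f // linear_sum fct_sumE; apply: eq_bigr => a _.
by rewrite linearZ /= -IH.
Qed.

End Coordinates.

(** * Intertwiners and uniqueness *)

Section Intertwiners.
Context (R : realType) (m n : nat) (u : 'M[R[i]]_(m * n)).

Definition intertwines (K L : hilbertType R) (p : representation u K)
    (q : representation u L) (G : bounded_op K L) : Prop :=
  (forall i x, G (rep_e p i x) = rep_e q i (G x)) /\
  (forall j x, G (rep_f p j x) = rep_f q j (G x)).

Lemma intertwines_comp (K L N : hilbertType R) (p : representation u K)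
    (q : representation u L) (r : representation u N)
    (G : bounded_op L N) (F : bounded_op K L) :
  intertwines q r G -> intertwines p q F -> intertwines p r (comp_op G F).
Proof. by move=> [Ge Gf] [Fe Ff]; split=> i x /=; rewrite ?Fe ?Ge ?Ff ?Gf. Qed.

(** With rows of isometries that add up to the identity, an intertwiner
    also respects adjoints: expand x as a sum of S_k S_k^* x. *)
Lemma intertwines_star (K L : hilbertType R) (p : representation u K)
    (q : representation u L) (G : bounded_op K L) :
  star_representation p -> star_representation q -> intertwines p q G ->
  (forall i x, G (adjoint (rep_e p i) x) = adjoint (rep_e q i) (G x)) /\
  (forall j x, G (adjoint (rep_f p j) x) = adjoint (rep_f q j) (G x)).
Proof.
move=> hp hq [Ge Gf]; split=> i x.
  rewrite -{2}[x]hp.2.1 !linear_sum (bigD1 i) //= Ge star_adj_e // eqxx scale1r.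
  by rewrite big1 ?addr0 // => k ki; rewrite Ge star_adj_e // eq_sym (negPf ki) scale0r.
rewrite -{2}[x]hp.2.2 !linear_sum (bigD1 i) //= Gf star_adj_f // eqxx scale1r.
by rewrite big1 ?addr0 // => k ki; rewrite Gf star_adj_f // eq_sym (negPf ki) scale0r.
Qed.

Lemma intertwines_adj (K L : hilbertType R) (p : representation u K)
    (q : representation u L) (G : bounded_op K L) :
  star_representation p -> star_representation q -> intertwines p q G ->
  intertwines q p (adj_op G).
Proof.
move=> hp hq Gpq; have [Ge Gf] := intertwines_star hp hq Gpq.
split=> i x /=; apply: adjoint_unique => z.
  by rewrite dotp_adjointr -Ge dotp_adjoint -dotp_adjointr.
by rewrite dotp_adjointr -Gf dotp_adjoint -dotp_adjointr.
Qed.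

(** The fixed vectors of G form a reducing subspace; invariance of its orthogonal
    complement comes from G commuting with the adjoints. *)
Lemma intertwiner_fix (H K : hilbertType R) (s : representation u H)
    (p : representation u K) (J : bounded_op H K) (G : bounded_op K K) :
  minimal_star_dilation s p J -> intertwines p p G ->
  (forall h, G (J h) = J h) -> forall x, G x = x.
Proof.
move=> [[_ Jmin] hp] Gp GJ x.
have [Ge Gf] := Gp; have [Ge' Gf'] := intertwines_star hp hp Gp.
suff fix_red : reducing p [set y | G y = y].
  have : smallest (reducing p) (range J) x by rewrite Jmin.
  by move/(_ [set y | G y = y]); apply; split=> // _ [h _ <-]; apply: GJ.
split.
- split=> [||a y z /= Gy Gz]; [|exact: linear0|by rewrite linearP Gy Gz].
  have lin : linear (fun y => G y - y).
    by move=> a y z; rewrite linearP scalerBr opprD addrACA.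
  pose D : {linear K -> K} := HB.pack (fun y => G y - y)
    (GRing.isLinear.Build R[i] K K _ _ lin).
  have [b b0 Gb] := bounded_op_ge0 G.
  have -> : [set y | G y = y] = [set y | D y = 0].
    apply/seteqP; split=> y /=; first by move=> ->; rewrite subrr.
    by move/eqP; rewrite subr_eq0 => /eqP.
  apply: (@closed_linear_ker _ _ _ D (b + 1)) => y.
  by rewrite mulrDl mul1r (le_trans (ler_normB _ _)) // lerD2r.
- by apply: invariant_under_gens => [i|j] y /= Gy; rewrite ?Ge ?Gf Gy.
- apply: invariant_under_gens => [i|j] y oy z /= Gz.
    rewrite -/(dotp _ _) dotp_adjointr; apply: oy.
    by rewrite /= Ge' Gz.
  rewrite -/(dotp _ _) dotp_adjointr; apply: oy.
  by rewrite /= Gf' Gz.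
Qed.

(** A contraction that preserves the norm of J h fixes J h under G^* G, so that
    [intertwiner_fix] applies to G^* G and to G G^*. *)
Lemma unitary_intertwiner (H K L : hilbertType R) (s : representation u H)
    (p : representation u K) (q : representation u L)
    (J : bounded_op H K) (I : bounded_op H L) (G : bounded_op K L) :
  minimal_star_dilation s p J -> minimal_star_dilation s q I ->
  intertwines p q G -> (forall x, `|G x| <= `|x|) ->
  (forall h, G (J h) = I h) -> unitary_op G.
Proof.
move=> hJ hI Gpq G1 GJ; have hp := hJ.2; have hq := hI.2.
have adjG h : adjoint G (I h) = J h.
  rewrite -GJ; apply: contraction_fix => //; rewrite GJ.
  have [[[Iiso _ _] _] _] := hI; have [[[Jiso _ _] _] _] := hJ.
  by rewrite Iiso Jiso.
have Gadj := intertwines_adj hp hq Gpq.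
split.
  apply: (intertwiner_fix hJ (G := comp_op (adj_op G) G)).
    exact: intertwines_comp Gadj Gpq.
  by move=> h /=; rewrite GJ adjG.
apply: (intertwiner_fix hI (G := comp_op G (adj_op G))).
  exact: intertwines_comp Gpq Gadj.
by move=> h /=; rewrite adjG GJ.
Qed.

End Intertwiners.

Theorem theorem5p1 (R : realType) (m n : nat) (hm : (1 <= m)%N)
    (hn : (1 <= n)%N) (u : 'M[R[i]]_(m * n)) (hu : u \is unitarymx)
    (H : hilbertType R) (sigma : representation u H)
    (hcontr : row_contractive sigma) (hdf : defect_free sigma) :
  (exists (K : hilbertType R) (p : representation u K) (J : bounded_op H K),
      minimal_star_dilation sigma p J) /\
  (forall (K1 K2 : hilbertType R)
      (p1 : representation u K1) (p2 : representation u K2)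
      (J1 : bounded_op H K1) (J2 : bounded_op H K2),
      minimal_star_dilation sigma p1 J1 ->
      minimal_star_dilation sigma p2 J2 ->
      exists U : bounded_op K1 K2,
        [/\ unitary_op U,
            forall x : H, J2 x = U (J1 x) &
            forall (w : seq ('I_m + 'I_n)) (y : K2),
              rep_word p2 w y = U (rep_word p1 w (adjoint U y))]).
Proof.
pose q := model_rep hu hcontr; pose J := embed (pair_defect_free hcontr hdf).
have hq : minimal_star_dilation sigma q J.
  by split; [apply: model_minimal|apply: model_star].
split; first by exists (modelH (pair_contraction hcontr)), q, J.
move=> K1 K2 p1 p2 J1 J2 h1 h2.
pose G1 := to_model hcontr hdf h1.2 h1.1.1.
pose G2 := to_model hcontr hdf h2.2 h2.1.1.
have G1q : intertwines p1 q G1.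
  by split=> i x; [apply: to_model_e|apply: to_model_f].
have G2q : intertwines p2 q G2.
  by split=> i x; [apply: to_model_e|apply: to_model_f].
have G1J h : G1 (J1 h) = J h by apply: to_model_embed.
have G2J h : G2 (J2 h) = J h by apply: to_model_embed.
have [G1K G1K'] := unitary_intertwiner h1 hq G1q (to_model_le _ _ _ _) G1J.
have [G2K G2K'] := unitary_intertwiner h2 hq G2q (to_model_le _ _ _ _) G2J.
exists (comp_op (adj_op G2) G1); split.
- split=> [x|y]; rewrite adjoint_comp adjoint_adj /=.
    by rewrite G2K' G1K.
  by rewrite G1K' G2K.
- by move=> x /=; rewrite G1J -G2J G2K.
move=> w y; have UE := intertwines_comp (intertwines_adj h2.2 hq.2 G2q) G1q.
rewrite (rep_word_intertwine UE.1 UE.2); congr rep_word.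
by rewrite adjoint_comp adjoint_adj /= G1K' G2K.
Qed.
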